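(* In the concrete model with a right-end simplicial mode $\chi$ ($\chi^2=\mathbb{1}$), let $S:=\lfloor (M+2)/3\rfloor$ and suppose $P_M(z)$ has $S$ pairwise distinct roots $z_1,\dots,z_S$ (necessarily nonzero since $P_M(0)=1$) and that $P_{M-r_M}(z_k)\neq0$ for all $k$, where $r_M=1$ for odd $M$ and $r_M=2$ for even $M$. Choose $u_k$ with $u_k^2=z_k$, set $u_{-k}:=-u_k$, $\epsilon_k:=u_k^{-1}$, and $$\Psi_k:=\frac{T_M(-u_k)\,\chi\,T_M(u_k)}{\mathcal{N}_k},\qquad \mathcal{N}_k=\mathcal{N}_{-k}:=4\sqrt{P_{M-r_M}(u_k^2)\,\big(-u_k^2P_M'(u_k^2)\big)}$$ (any fixed branch of the square root), for $k=\pm1,\dots,\pm S$, where $P_M'$ is the derivative in $z$. Then $[H_M,\Psi_k]=2\epsilon_k\Psi_k$ and $\{\Psi_k,\Psi_{k'}\}=\delta_{k+k',0}\,\mathbb{1}$ for all $k,k'\in\{\pm1,\dots,\pm S\}$.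
   Context: Concrete model. Fix an integer $M\ge1$ and complex numbers $b_1,\dots,b_M$. Let $h_1,\dots,h_M$ be elements of a unital associative complex algebra satisfying $h_m^2=b_m^2\mathbb{1}$, $h_mh_{m+1}=-h_{m+1}h_m$, $h_mh_{m+2}=-h_{m+2}h_m$, and $h_mh_l=h_lh_m$ for $|l-m|>2$ (e.g. $h_m=b_m\sigma^z_m\sigma^z_{m+1}\sigma^x_{m+2}$ on a spin chain). Set $h_j:=0$, $b_j:=0$ for $j\le 0$ or $j>M$. Let $\beta_3,\beta_5$ be arbitrary complex numbers and define $\beta_{2m+1}:=\beta_{2m-1}/(b_{2m-4}^2\beta_{2m-3}-b_{2m}^2\beta_{2m-1}+1)$ for $m\ge3$ (denominators assumed nonzero). For $2\le m\le\lfloor M/2\rfloor$ put $\bar h_{2m+1}:=\beta_{2m-1}h_{2m-2}h_{2m-3}h_{2m}$ and $\bar b_{2m+1}:=\beta_{2m-1}b_{2m-2}b_{2m-3}b_{2m}$ (so $\bar h_{2m+1}^2=\bar b_{2m+1}^2\mathbb{1}$); otherwise $\bar h_{2m+1}:=0$, $\bar b_{2m+1}:=0$. For $1\le j\le M$, the model of size $j$ (same couplings) has frustration graph $G_j$ with vertices $h_1,\dots,h_j$ and $\bar h_{2m+1}$ for $2\le m\le\lfloor j/2\rfloor$, and edges $h_i\sim h_l$ iff $|i-l|\in\{1,2\}$; $\bar h_{2m-1}\sim h_l$ iff $l\in\{2m-7,2m-5,2m-3,2m-1,2m-2,2m\}$; $\bar h_{2m-1}\sim\bar h_{2m'-1}$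 iff $|m-m'|=1$ (adjacent vertices anticommute, non-adjacent distinct ones commute). Charges: $Q_j^{(k)}:=\sum_{S}\prod_{v\in S}v$, the sum over independent sets $S$ of $G_j$ of size $k$ ($Q_j^{(0)}=\mathbb{1}$). Hamiltonian $H_j:=Q_j^{(1)}=\sum_{l=1}^j h_l+\sum_{m=2}^{\lfloor j/2\rfloor}\beta_{2m-1}h_{2m-2}h_{2m-3}h_{2m}$. Transfer matrix $T_j(u):=\sum_{k\ge0}(-u)^kQ_j^{(k)}$ for $u\in\mathbb{C}$, with $T_j(u):=\mathbb{1}$ for $j\le 0$. It is known that $T_j(u)T_j(-u)=P_j(u^2)\mathbb{1}$ for a scalar polynomial $P_j\in\mathbb{C}[z]$ (with $P_j:=1$ for $j\le0$). Right-end simplicial mode: an element $\chi$ of the ambient algebra such that, if $M$ is even, $\chi$ anticommutes with $h_M$ and $h_{M-1}$ and commutes with $h_l$ for $l<M-1$, and the simplicial clique is $K_M=\{h_{M-1},h_M,\bar h_{M+1}\}$; if $M$ is odd, $\chi$ anticommutes with $h_M$ and commutes with $h_l$ for $l<M$, and $K_M=\{h_M\}$. *)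

(* Defs.v *)
From HB Require Import structures.
From mathcomp Require Import all_boot all_algebra.
From mathcomp Require Import complex reals.
Set Implicit Arguments. Unset Strict Implicit. Unset Printing Implicit Defensive.
Import GRing.Theory.
Local Open Scope ring_scope.

(* Vertices of the frustration graph G_j:
   Hv l  stands for h_l          (1 <= l <= j)
   Bv m  stands for \bar h_{2m+1} (2 <= m <= j/2). *)
Inductive vkind := Hv of nat | Bv of nat.

(* Adjacency of G_j (paper's rule with \bar h_{2m-1} renamed \bar h_{2m+1}):
   h_i ~ h_l iff |i-l| in {1,2};
   \bar h_{2m+1} ~ h_l iff l in {2m-5,2m-3,2m-1,2m+1,2m,2m+2};
   \bar h_{2m+1} ~ \bar h_{2m'+1} iff |m-m'| = 1. *)
Definition vadj (v w : vkind) : bool :=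
  match v, w with
  | Hv i, Hv l => [|| i == l.+1, i == l.+2, l == i.+1 | l == i.+2]
  | Bv m, Hv l | Hv l, Bv m =>
      [|| (l + 5 == 2 * m)%N, (l + 3 == 2 * m)%N, (l + 1 == 2 * m)%N,
          (l == 2 * m + 1)%N, (l == 2 * m)%N | (l == 2 * m + 2)%N]
  | Bv m, Bv m' => (m == m'.+1) || (m' == m.+1)
  end.

Definition vert (j : nat) : seq vkind :=
  [seq Hv l | l <- iota 1 j] ++ [seq Bv m | m <- iota 2 (j./2).-1].

Definition nv (j : nat) : nat := size (vert j).

Definition vat (j : nat) (i : 'I_(nv j)) : vkind := nth (Hv 0) (vert j) i.

Definition indep (j : nat) (S : {set 'I_(nv j)}) : bool :=
  [forall x in S, forall y in S, ~~ vadj (vat x) (vat y)].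

Section Model.
Variables (K : comNzRingType) (A : lalgType K) (h : nat -> A) (beta : nat -> K).

Definition vval (v : vkind) : A :=
  match v with
  | Hv l => h l
  | Bv m => beta (2 * m - 1) *: (h (2 * m - 2) * h (2 * m - 3) * h (2 * m))
  end.

(* Q_j^(k): sum over independent sets of size k of the product of their
   (pairwise commuting) elements, taken in the fixed vertex order. *)
Definition charge (j k : nat) : A :=
  \sum_(S : {set 'I_(nv j)} | indep S && (#|S| == k))
     \prod_(i <- enum S) vval (vat i).

Definition ham (j : nat) : A := charge j 1.

Definition transfer (j : nat) (u : K) : A :=
  \sum_(k < (nv j).+1) ((- u) ^+ k) *: charge j k.

End Model.

(* Main.v *)
(* Write T = T_M, t = T_{M-r}, X = H_M - H_{M-r} (the sum over the clique K_M).
   Everything rests on three facts: 2 T(u) = 2 t(u) - u {X, t(u)}, X^2 is a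
   scalar, and [H_M, T_M(u)] = 0.  The first two give
   (1 - u X) chi T(u) = T(u) (1 + u X) chi, so that
   Phi(u) = T(-u) chi T(u) solves
   Phi - (u/2) [H, Phi] = P_M(u^2) (1 + u X) chi;
   at a root a of P_M(u^2) this is the eigenvalue equation, and
   {chi, Phi(a)} = 4 P_{M-r}(a^2).  Hence F(u) = {Phi(u), Phi(a)} satisfies a
   linear equation whose coefficients in u show that F(u) commutes with H, and
   (a + u) F(u) = 4 P_{M-r}(a^2) P_M(u^2) (a - u).  Dividing by a + u yields all
   anticommutators.
   P_M has degree at most S because independent sets have at most S elements,
   so its S roots are simple and N_k is nonzero.

   For even M the graph has claws, and [H_M, T_M(u)] = 0 comes from the recursion
   for beta.  The even T_j obey a linear recursion of order four in terms of
   T_{j-2}, T_{j-4}, T_{j-6}, T_{j-8} with coefficients in a few neighbouring h's,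
   so the required identities are identities between words in signed-commuting
   letters and are decided by a verified normal form. *)
Require Import Defs.
From HB Require Import structures.
From mathcomp Require Import all_boot all_order all_algebra.
From mathcomp Require Import complex reals.
From mathcomp Require Import zify ring.
Set Implicit Arguments. Unset Strict Implicit. Unset Printing Implicit Defensive.
Import GRing.Theory.
Local Open Scope ring_scope.

(** * Normal forms of words in signed-commuting letters *)

Inductive ncexpr :=
  | Var of nat | One | Add of ncexpr & ncexpr | Opp of ncexpr
  | Mul of ncexpr & ncexpr.

Section SignedWords.
(* [cm i j = Some s]: letters [i] and [j] commute up to the sign [(-1)^s];
   [sq i = Some c]: the square of letter [i] is letter [c]. *)
Variables (cm : nat -> nat -> option bool) (sq : nat -> option nat).

(** Left multiplication of a sorted word by one letter. A square rule replaces two equal letters by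
    a third, which is inserted again. Where [cm] has no rule the letter stays put, so results are
    correct but need not be canonical. *)
Fixpoint ins (i : nat) (m : seq nat) : bool * seq nat :=
  if m is j :: m' then
    if i == j then (if sq i is Some c then ins c m' else (false, i :: m))
    else if (i < j)%N then (false, i :: m)
    else if cm i j is Some s then
      let r := ins i m' in (s (+) r.1, j :: r.2)
    else (false, i :: m)
  else (false, [:: i]).

Definition tmul (t1 t2 : bool * seq nat) : bool * seq nat :=
  foldr (fun i r => let r' := ins i r.2 in (r.1 (+) r'.1, r'.2))
    (t1.1 (+) t2.1, t2.2) t1.2.

Definition topp (t : bool * seq nat) := (~~ t.1, t.2).

Fixpoint cmpw (m n : seq nat) : comparison :=
  match m, n with
  | [::], [::] => Eq
  | [::], _ => Lt
  | _, [::] => Gt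
  | i :: m', j :: n' =>
      if i == j then cmpw m' n' else if (i < j)%N then Lt else Gt
  end.

(** Coefficients are mere signs: a multiple of a word is a repeated entry, and equal words with
    opposite signs cancel. *)
Fixpoint merge (L1 : seq (bool * seq nat)) : seq (bool * seq nat) -> seq (bool * seq nat) :=
  if L1 is s :: L1' then
    fix merge_s L2 := if L2 is t :: L2' then
      match cmpw s.2 t.2 with
      | Lt => s :: merge L1' L2
      | Gt => t :: merge_s L2'
      | Eq => if s.1 (+) t.1 then merge L1' L2' else s :: t :: merge L1' L2'
      end
    else L1
  else id.

(** Bottom-up merge sort run as a binary counter: slot i is meant for a merge of 2^i lists, and an
    empty list marks a free slot. *)
Fixpoint push L (LL : seq (seq (bool * seq nat))) :=
  match LL with
  | [::] => [:: L]
  | [::] :: LL' => L :: LL'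
  | L' :: LL' => [::] :: push (merge L L') LL'
  end.

Definition msort (L : seq (bool * seq nat)) :=
  foldr merge [::] (foldr (fun t => push [:: t]) [::] L).

Fixpoint nf (x : ncexpr) : seq (bool * seq nat) :=
  match x with
  | Var i => [:: (false, [:: i])]
  | One => [:: (false, [::])]
  | Add x y => merge (nf x) (nf y)
  | Opp x => map topp (nf x)
  | Mul x y =>
      msort [seq tmul s t | s <- nf x, t <- nf y]
  end.

Variables (A : nzRingType) (e : nat -> A).

Fixpoint nceval (x : ncexpr) : A :=
  match x with
  | Var i => e i
  | One => 1
  | Add x y => nceval x + nceval y
  | Opp x => - nceval x
  | Mul x y => nceval x * nceval y
  end.

Hypothesis cmP : forall i j s, cm i j = Some s ->
  e i * e j = (-1) ^+ s * (e j * e i).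
Hypothesis sqP : forall i c, sq i = Some c -> e i * e i = e c.

Let tev (t : bool * seq nat) : A := (-1) ^+ t.1 * \prod_(i <- t.2) e i.
Let pev L : A := \sum_(t <- L) tev t.

Let ins_eval i m : tev (ins i m) = e i * \prod_(j <- m) e j.
Proof.
elim: m i => [|j m IH] i /=; first by rewrite /tev /= mul1r !big_cons.
case: eqP => [<-|_].
  case E: (sq i) => [c|]; last by rewrite /tev mul1r !big_cons.
  by rewrite IH big_cons mulrA (sqP E).
case: ifP => _; first by rewrite /tev mul1r !big_cons.
case E: (cm i j) => [s|]; last by rewrite /tev mul1r !big_cons.
rewrite {1}/tev /= !big_cons [RHS]mulrA (cmP E) -!mulrA -IH /tev signr_addb.
by rewrite -mulrA [e j * (_ * _)]mulrA commr_sign -mulrA.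
Qed.

Let tmul_eval s t : tev (tmul s t) = tev s * tev t.
Proof.
case: s t => a m [b n]; rewrite /tmul /=.
elim: m => [|i m IH] /=.
  by rewrite /tev /= big_nil mulr1 signr_addb mulrA.
move: IH; set r := foldr _ _ m => IH.
have -> : tev (r.1 (+) (ins i r.2).1, (ins i r.2).2) =
   (-1) ^+ r.1 * tev (ins i r.2) by rewrite /tev /= signr_addb mulrA.
have E k : (-1) ^+ k * (e i * \prod_(j <- r.2) e j) =
   e i * ((-1) ^+ k * \prod_(j <- r.2) e j).
  by rewrite [RHS]mulrA commr_sign -mulrA.
rewrite ins_eval E -/(tev (r.1, r.2)) -surjective_pairing IH.
by rewrite /tev /= big_cons !mulrA [e i * _]commr_sign.
Qed.

Let topp_eval t : tev (topp t) = - tev t.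
Proof. by case: t => -[] m; rewrite /tev /= !(mul1r, mulN1r, opprK). Qed.

Let cmpw_eq m n : cmpw m n = Eq -> m = n.
Proof.
elim: m n => [|i m IH] [|j n] //=.
by case: eqP => [-> /IH ->|_] //; case: ifP.
Qed.

Let merge_eval L1 L2 : pev (merge L1 L2) = pev L1 + pev L2.
Proof.
elim: L1 L2 => [|s L1 IH1] L2; first by rewrite /pev big_nil add0r.
elim: L2 => [|t L2 IH2]; first by rewrite /pev big_nil addr0.
have cons x L : pev (x :: L) = tev x + pev L by rewrite /pev big_cons.
rewrite [merge _ _]/=; case E: (cmpw s.2 t.2).
- have {E IH2} := cmpw_eq E; case: s t => a m [b n] /= ->.
  case Eab: (a (+) b); rewrite ?cons IH1 addrACA.
    have -> : tev (b, n) = - tev (a, n).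
      by rewrite -topp_eval /topp; case: a b Eab => -[].
    by rewrite subrr add0r.
  by rewrite -addrA.
- by rewrite !cons IH1 cons addrA.
- by rewrite [LHS]cons IH2 !cons addrCA.
Qed.

Let msort_eval L : pev (msort L) = pev L.
Proof.
have pev0 : pev [::] = 0 by rewrite /pev big_nil.
rewrite /msort; set LL := foldr _ _ _.
have fold_eval (M : seq (seq (bool * seq nat))) :
    pev (foldr merge [::] M) = \sum_(N <- M) pev N.
  by elim: M => [|N M IH]; rewrite ?big_nil //= merge_eval IH big_cons.
have push_eval N M : \sum_(P <- push N M) pev P = pev N + \sum_(P <- M) pev P.
  elim: M N => [|[|t P] M IH] N.
  - by rewrite big_nil addr0 [push _ _]/= big_cons big_nil addr0.
  - by rewrite [push _ _]/= !big_cons pev0 add0r.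
  by rewrite [push _ _]/= !big_cons IH merge_eval pev0 add0r addrA.
rewrite fold_eval {}/LL; elim: L => [|t L IH]; first by rewrite big_nil pev0.
by rewrite /= push_eval IH /pev !big_cons big_nil addr0.
Qed.

Lemma nf_eval x : nceval x = \sum_(t <- nf x) ((-1) ^+ t.1 * \prod_(i <- t.2) e i).
Proof.
rewrite -/(pev (nf x)); elim: x => [i||x IHx y IHy|x IHx|x IHx y IHy] /=.
- by rewrite /pev big_seq1 /tev big_seq1 mul1r.
- by rewrite /pev big_seq1 /tev big_nil mul1r.
- by rewrite merge_eval IHx IHy.
- rewrite IHx /pev big_map -sumrN; apply: eq_bigr => t _.
  by rewrite topp_eval.
rewrite msort_eval IHx IHy /pev big_allpairs_dep mulr_suml.
apply: eq_bigr => s _; rewrite mulr_sumr; apply: eq_bigr => t _.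
exact/esym/tmul_eval.
Qed.

(** Soundness suffices here: an empty normal form of the difference certifies the identity. *)
Lemma nceval_eq x y : nf (Add x (Opp y)) = [::] -> nceval x = nceval y.
Proof.
move=> E; have := nf_eval (Add x (Opp y)).
by rewrite E big_nil /= => /eqP; rewrite subr_eq0 => /eqP.
Qed.
End SignedWords.

(** * Identities with some central letters, and a tactic deciding them *)

Section Central.
Variables (A : nzRingType) (env : seq A) (k : nat).

Definition central (x : A) := forall y, x * y = y * x.

Definition cm_central (i j : nat) : option bool :=
  if (i < k)%N || (j < k)%N then Some false else None.

Lemma nc_central x y :
  foldr (fun a P => central a /\ P) True (take k env) ->
  nf cm_central (fun=> None) (Add x (Opp y)) = [::] ->
  nceval (nth 0 env) x = nceval (nth 0 env) y.
Proof.
move=> cen; apply: nceval_eq => // i j s; rewrite /cm_central.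
have cenP i' : (i' < k)%N -> central (nth 0 env i').
  elim: env k i' cen => [|a e IH] [|k'] [|i'] //=; rewrite ?nth_nil.
  - by move=> _ _ y'; rewrite mul0r mulr0.
  - by move=> _ _ y'; rewrite mul0r mulr0.
  - by case.
  - by case=> _ /IH H ltk; apply: H.
case: ifP => // /orP lt [<-]; rewrite mul1r.
by case: lt => /cenP; [exact | move=> c; rewrite c].
Qed.
End Central.

Ltac nc_index x env :=
  lazymatch env with
  | x :: _ => constr:(0%N)
  | _ :: ?e => let n := nc_index x e in constr:(n.+1)
  end.

Ltac nc_reify env t :=
  lazymatch t with
  | @GRing.add _ ?a ?b =>
      let x := nc_reify env a in let y := nc_reify env b in constr:(Add x y)
  | @GRing.opp _ ?a => let x := nc_reify env a in constr:(Opp x)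
  | @GRing.mul _ ?a ?b =>
      let x := nc_reify env a in let y := nc_reify env b in constr:(Mul x y)
  | @GRing.one _ => constr:(One)
  | ?a => let n := nc_index a env in constr:(Var n)
  end.

(* Proves an identity of noncommutative polynomials in the entries of [env],
   of which the first [k] are central. *)
Ltac nc_ring k env :=
  lazymatch goal with
  | |- @eq _ ?a ?b =>
      let x := nc_reify env a in let y := nc_reify env b in
      apply: (@nc_central _ env k x y);
      [by do ?[split=> //] | by vm_compute]
  end.

(** * Transfer matrices as recursions over vertex lists *)

Lemma vadjC v w : vadj v w = vadj w v.
Proof. by case: v w => [i|m] [l|m'] /=; do ?apply/idP/idP; lia. Qed.

Lemma vadjxx v : vadj v v = false.
Proof. by case: v => [i|m] /=; lia. Qed.

Section ListTransfer.
Variables (K : comNzRingType) (A : algType K).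

(* Sum over the independent sets of the vertices of [V] that satisfy [ok]. *)
Fixpoint itp (val : vkind -> A) (u : K) (ok : pred vkind) (V : seq vkind) : A :=
  if V is v :: V' then
    itp val u ok V' - (if ok v then
      u *: (val v * itp val u (fun w => ok w && ~~ vadj v w) V') else 0)
  else 1.

Lemma itp_cons val u ok v V : itp val u ok (v :: V) =
  itp val u ok V - (if ok v then
    u *: (val v * itp val u (fun w => ok w && ~~ vadj v w) V) else 0).
Proof. by []. Qed.

Lemma eq_in_itp val u (ok ok' : pred vkind) V :
  (forall v, List.In v V -> ok v = ok' v) -> itp val u ok V = itp val u ok' V.
Proof.
elim: V ok ok' => //= v V IH ok ok' E.
rewrite (IH ok ok') => [|w wV]; last by apply: E; right.
rewrite E; last by left.
rewrite (IH (fun w => ok w && ~~ vadj v w)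
  (fun w => ok' w && ~~ vadj v w)) // => w wV.
by rewrite E //; right.
Qed.

Lemma eq_itp val u (ok ok' : pred vkind) V :
  ok =1 ok' -> itp val u ok V = itp val u ok' V.
Proof. by move=> E; apply: eq_in_itp => v _; apply: E. Qed.

Lemma itp_map val u (f : vkind -> vkind) ok V :
  (forall v w, vadj (f v) (f w) = vadj v w) ->
  itp val u ok (map f V) = itp (val \o f) u (ok \o f) V.
Proof.
move=> E; elim: V ok => //= v V IH ok; rewrite !IH; congr (_ - _).
by case: ifP => // _; congr (_ *: (_ * _)); apply: eq_itp => w /=; rewrite E.
Qed.

Lemma eq_in_itp_val val val' u ok V :
  (forall v, List.In v V -> val v = val' v) -> itp val u ok V = itp val' u ok V.
Proof.
elim: V ok => //= v V IH ok E; rewrite !IH ?E //; first by left.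
- by move=> w ?; apply: E; right.
- by move=> w ?; apply: E; right.
Qed.

(** Serves to absorb the zero-valued extra vertices of the translated chain. *)
Lemma itp_zero_vals val u ok V W :
  (forall v, List.In v W -> val v = 0) -> itp val u ok (V ++ W) = itp val u ok V.
Proof.
move=> E; elim: V ok => [|v V IH] ok /=; last by rewrite !IH.
elim: W ok E => //= w W IH ok E.
rewrite E ?mul0r ?scaler0; last by left.
by rewrite if_same subr0 IH // => v ?; apply: E; right.
Qed.

Lemma itp_comm val u ok V x :
  (forall v, List.In v V -> x * val v = val v * x) ->
  x * itp val u ok V = itp val u ok V * x.
Proof.
elim: V ok => [|v V IH] ok E /=; first by rewrite mulr1 mul1r.
have EV w : List.In w V -> x * val w = val w * x by move=> ?; apply: E; right.
rewrite mulrBr mulrBl IH //; congr (_ - _).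
case: ifP => _; last by rewrite mulr0 mul0r.
rewrite -scalerAr -scalerAl; congr (_ *: _).
by rewrite mulrA E; [rewrite -!mulrA IH | left].
Qed.

Section Perm.
Variables (val : vkind -> A) (u : K).
Hypothesis valC : forall v w, vadj v w = false -> val v * val w = val w * val v.

(** Expanding at both vertices gives the same linear terms. The quadratic term is absent if they are
    adjacent and symmetric otherwise, since they then commute. *)
Lemma itp_swap ok v w V :
  itp val u ok (v :: w :: V) = itp val u ok (w :: v :: V).
Proof.
rewrite /= (vadjC w v).
case: (ok v) => //=; case: (ok w) => //=; rewrite ?subr0 //.
case E: (vadj v w) => /=; first by rewrite !subr0 addrAC.
  rewrite !mulrBr !scalerBr !opprB.
  rewrite -!scalerAr !mulrA (valC E).
  rewrite (@eq_itp val u (fun x => (ok x && ~~ vadj v x) && ~~ vadj w x)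
            (fun x => (ok x && ~~ vadj w x) && ~~ vadj v x)); last first.
    by move=> x; rewrite andbAC.
  rewrite ![in LHS]addrA ![in RHS]addrA.
  set a := itp _ _ _ _; set b := u *: _; set c := u *: _; set d := u *: (u *: _).
  by rewrite -!addrA; congr (a + _); rewrite addrCA [RHS]addrCA [- b - c]addrC.
Qed.

Lemma itp_move ok v V W :
  itp val u ok (V ++ v :: W) = itp val u ok (v :: V ++ W).
Proof.
elim: V ok => [|w V IH] ok //.
transitivity (itp val u ok (w :: v :: V ++ W)); last exact: itp_swap.
by rewrite /= in IH *; rewrite !IH.
Qed.

(** Allows the vertices to be relisted clique by clique, which is the order suited to recursions. *)
Lemma itp_perm (T : eqType) (f : T -> vkind) ok (s t : seq T) :
  perm_eq s t -> itp val u ok (map f s) = itp val u ok (map f t).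
Proof.
elim: s t ok => [|x s IH] t ok; first by rewrite perm_sym => /perm_nilP ->.
move=> st; have xt : x \in t by rewrite -(perm_mem st) mem_head.
case/splitPr: xt st => t1 t2 st.
have {}st : perm_eq s (t1 ++ t2).
  by rewrite -(perm_cons x) (perm_trans st) // -(cat1s x t2) perm_catCA.
by rewrite map_cat /= itp_move /= -map_cat !(IH _ _ st).
Qed.
End Perm.


(** * Agreement of the list recursion with sums over independent sets *)

Section SetSums.
Variables (I : finType) (l : I -> vkind) (val : vkind -> A) (u : K).

(** The predicate [ok] records the vertices not excluded by earlier choices, as in the recursion of
    [itp]. *)
Definition indset (ok : pred vkind) (S : {set I}) :=
  [forall x in S, ok (l x) && [forall y in S, ~~ vadj (l x) (l y)]].

Lemma indset_setU1 ok i S : indset ok (i |: S) =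
  ok (l i) && indset (fun w => ok w && ~~ vadj (l i) w) S.
Proof.
apply/forall_inP/andP => [H|[oki /forall_inP H] x].
  have /andP[-> /forall_inP Hi] := H i (setU11 i S); split=> //.
  apply/forall_inP => x xS; have xU : x \in i |: S by rewrite setU1r.
  have /andP[-> /forall_inP Hx] := H x xU; rewrite Hi //=.
  by apply/forall_inP => y yS; apply: Hx; rewrite setU1r.
rewrite !inE => /orP[/eqP->|xS].
  rewrite oki; apply/forall_inP => y; rewrite !inE => /orP[/eqP->|yS].
    by rewrite vadjxx.
  by have /andP[/andP[_ ->] _] := H y yS.
have /andP[/andP[-> ix] /forall_inP Hx] := H x xS.
apply/forall_inP => y; rewrite !inE => /orP[/eqP->|yS]; last exact: Hx.
by rewrite vadjC.
Qed.

(** Sets avoiding the head vertex give the first term of [itp]. Sets containing it are that vertex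
    joined to an independent set outside its neighbourhood, which gives the second. *)
Lemma sum_indset ok (s : seq I) : uniq s ->
  \sum_(S : {set I} | (S \subset s) && indset ok S)
     (- u) ^+ #|S| *: \prod_(i <- s | i \in S) val (l i) =
  itp val u ok (map l s).
Proof.
elim: s ok => [|i s IH] ok /=.
  rewrite (big_pred1 set0) => [|S]; first by rewrite cards0 big_nil scale1r.
  apply/andP/eqP => [[/subsetP E _]|->].
    by apply/setP => x; rewrite inE; apply/negP => /E.
  split; first by apply/subsetP => x; rewrite inE.
  by apply/forall_inP => x; rewrite inE.
case/andP=> i_s us; rewrite (bigID (fun S : {set I} => i \in S)) /= addrC.
congr (_ + _).
  rewrite -(IH _ us); apply: eq_big => [S|S /andP[_ iS]].
    rewrite andbAC; congr (_ && _).
    apply/andP/subsetP => [[/subsetP H iS] x xS|H].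
      by have := H x xS; rewrite inE; case/orP => // /eqP xi; rewrite -xi xS in iS.
    split; first by apply/subsetP => x /H xs; rewrite inE xs orbT.
    by apply/negP => /H; apply/negP.
  by rewrite big_cons (negbTE iS).
pose ok' w := ok w && ~~ vadj (l i) w.
rewrite (reindex_onto (fun S => i |: S) (fun S => S :\ i)) /=; last first.
  by move=> S /andP[_ iS]; rewrite setD1K.
case: ifP => oki; last first.
  rewrite oppr0 big_pred0 // => S; rewrite indset_setU1 oki.
  by rewrite andbF.
rewrite -(IH ok' us) mulr_sumr scaler_sumr -sumrN.
apply: eq_big => [S|S /andP[/andP[/andP[/subsetP sub _] _] /eqP E]].
  rewrite indset_setU1 oki /= setU11 andbT andbAC; congr (_ && _).
  apply/andP/subsetP => [[/subsetP H /eqP E] x xS|H].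
    have /H : x \in i |: S by rewrite setU1r.
    rewrite inE => /orP[/eqP xi|//].
    by move: xS; rewrite -E xi !inE eqxx.
  split; first by apply/subsetP => x; rewrite !inE => /orP[->//|/H ->]; rewrite orbT.
  by rewrite setU1K //; apply/negP => /H; apply/negP.
have iS : i \notin S by rewrite -E !inE eqxx.
rewrite cardsU1 iS add1n big_cons setU11 exprS mulNr scaleNr -scalerAr scalerA.
congr (- (_ *: (_ * _))); rewrite big_seq_cond [RHS]big_seq_cond.
apply: eq_bigl => x; rewrite !inE; case: eqP => // -> /=.
by rewrite (negbTE i_s).
Qed.
End SetSums.


Lemma charge_indset h beta j k : charge h beta j k =
  \sum_(S : {set 'I_(nv j)} | indset (@vat j) predT S && (#|S| == k))
    \prod_(i <- enum 'I_(nv j) | i \in S) @vval K A h beta (vat i).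
Proof.
apply: eq_big => [S|S _] //; by rewrite {1}/enum_mem -enumT big_filter.
Qed.

Lemma transferE h beta j u :
  transfer h beta j u = itp (@vval K A h beta) u predT (vert j).
Proof.
have -> : vert j = map (@vat j) (enum 'I_(nv j)).
  apply: (@eq_from_nth _ (Hv 0)); first by rewrite size_map size_enum_ord.
  move=> i lti; rewrite (nth_map (Ordinal lti)) ?size_enum_ord //.
  by rewrite /vat nth_enum_ord.
rewrite -sum_indset ?enum_uniq // /transfer.
under eq_bigr do rewrite charge_indset scaler_sumr.
(* Every independent set occurs in exactly one charge, that of its cardinality. *)
rewrite (exchange_big_dep (indset (@vat j) predT)) /=; last first.
  by move=> k S _ /andP[].
apply: eq_big => [S|S iS].
  by rewrite (_ : _ \subset _) //; apply/subsetP => x _; rewrite mem_enum.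
have lt : (#|S| < (nv j).+1)%N by rewrite ltnS -[leqRHS]card_ord max_card.
by rewrite (big_pred1 (Ordinal lt)) // => k; rewrite iS /= -val_eqE eq_sym.
Qed.

Lemma hamE h beta j :
  ham h beta j = \sum_(v <- vert j) @vval K A h beta v.
Proof.
rewrite /ham charge_indset.
rewrite (eq_bigl (fun S : {set 'I_(nv j)} => #|S| == 1%N)); last first.
  move=> S; case: eqP => [/eqP/cards1P[i ->]|_]; rewrite ?andbF // andbT.
  apply/forall_inP => x /set1P ->; apply/forall_inP => y /set1P ->.
  by rewrite vadjxx.
rewrite (eq_bigl (mem [set [set i] | i in [set: 'I_(nv j)]])) => [|S]; last first.
  apply/cards1P/imsetP => [[i ->]|[i _ ->]]; exists i => //.
rewrite big_imset /=; last by move=> i i' _ _ /set1_inj.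
rewrite (big_nth (Hv 0)) big_mkord; apply: eq_big => [i|i _]; first by rewrite inE.
rewrite (eq_bigl (pred1 i)) => [|i']; last by rewrite inE.
by rewrite -big_filter filter_pred1_uniq ?enum_uniq ?mem_enum // big_seq1.
Qed.

End ListTransfer.

(** * Recursions for the even-size transfer matrices *)

Definition hadj (i l : nat) : bool := [&& i != l, i <= l.+2 & l <= i.+2]%N.

(* The graph of size [2 n], listed clique by clique; it contains the spurious
   vertex [Bv 1], whose value vanishes as soon as [h 0 = 0]. *)
Fixpoint evert (n : nat) : seq vkind :=
  if n is k.+1 then [:: Hv k.*2.+1, Hv k.*2.+2, Bv k.+1 & evert k] else [::].

Lemma evert_inv n v : List.In v (evert n) ->
  match v with Hv l => (1 <= l <= n.*2)%N | Bv m => (1 <= m <= n)%N end.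
Proof.
elim: n v => //= n IH v [<-|[<-|[<-|/IH]]]; rewrite ?leqnn //; try lia.
by case: v => [l|m]; lia.
Qed.

Ltac bool_lia b :=
  first [ (have -> : b = true by rewrite /= /hadj; lia)
        | (have -> : b = false by rewrite /= /hadj; lia) ].

(** The sign between [Bv m] and [h l] is the parity of the number of its three factors that
    anticommute with [h l]. All adjacencies vanish outside 2m-5 <= l <= 2m+2, leaving eight
    cases. *)
Lemma vadj_BH m l : (2 <= m)%N -> (1 <= l)%N -> vadj (Bv m) (Hv l) =
  hadj (2 * m - 2) l (+) hadj (2 * m - 3) l (+) hadj (2 * m) l.
Proof.
move=> m2 l1.
have : [|| l + 6 <= 2 * m, 2 * m + 3 <= l |
   (l + 5)%N \in [seq (2 * m + i)%N | i <- iota 0 8]]%N.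
  apply/or3P; have [?|?] := leqP (l + 6) (2 * m); first by constructor 1.
  have [?|?] := leqP (2 * m + 3) l; first by constructor 2.
  by constructor 3; apply/mapP; exists (l + 5 - 2 * m)%N; rewrite ?mem_iota; lia.
rewrite !inE.
case/or4P => [Hl|Hl|/eqP Hl|/or4P[/eqP Hl|/eqP Hl|/eqP Hl|
    /or4P[/eqP Hl|/eqP Hl|/eqP Hl|/eqP Hl]]];
  bool_lia (hadj (2 * m - 2) l); bool_lia (hadj (2 * m - 3) l);
  bool_lia (hadj (2 * m) l); bool_lia (vadj (Bv m) (Hv l)); by [].
Qed.

Lemma vadj_BB m m' : (2 <= m)%N -> (2 <= m')%N -> vadj (Bv m) (Bv m') =
  vadj (Hv (2 * m - 2)) (Bv m') (+) vadj (Hv (2 * m - 3)) (Bv m')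
    (+) vadj (Hv (2 * m)) (Bv m').
Proof.
move=> m2 m2'.
have : [|| m + 4 <= m', m' + 4 <= m |
   (m + 3)%N \in [seq (m' + i)%N | i <- iota 0 7]]%N.
  apply/or3P; have [?|?] := leqP (m + 4) m'; first by constructor 1.
  have [?|?] := leqP (m' + 4) m; first by constructor 2.
  by constructor 3; apply/mapP; exists (m + 3 - m')%N; rewrite ?mem_iota; lia.
rewrite !inE.
case/or4P => [Hl|Hl|/eqP Hl|/or4P[/eqP Hl|/eqP Hl|/eqP Hl|/or3P[/eqP Hl|/eqP Hl|/eqP Hl]]];
  bool_lia (vadj (Hv (2 * m - 2)) (Bv m')); bool_lia (vadj (Hv (2 * m - 3)) (Bv m'));
  bool_lia (vadj (Hv (2 * m)) (Bv m')); bool_lia (vadj (Bv m) (Bv m')); by [].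
Qed.

Section Chain.
Variables (K : comNzRingType) (A : algType K).
Variables (h : nat -> A) (beta : nat -> K).
Hypothesis h0 : h 0 = 0.
Hypothesis hC1 : forall m, h m * h m.+1 = - (h m.+1 * h m).
Hypothesis hC2 : forall m, h m * h m.+2 = - (h m.+2 * h m).
Hypothesis hC3 : forall m l, (m.+2 < l)%N -> h m * h l = h l * h m.

Notation val := (@vval K A h beta).

Lemma hadj_comm i l : h i * h l = (-1) ^+ hadj i l * (h l * h i).
Proof.
have near i' : h i' * h i'.+1 = - (h i'.+1 * h i') /\ h i'.+1 * h i' = - (h i' * h i'.+1).
  by rewrite hC1 opprK.
have near2 i' : h i' * h i'.+2 = - (h i'.+2 * h i') /\ h i'.+2 * h i' = - (h i' * h i'.+2).
  by rewrite hC2 opprK.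
case E: (hadj i l); rewrite ?mulN1r ?mul1r; move: E; rewrite /hadj => E.
  have [->|[->|[->|->]]] : l = i.+1 \/ l = i.+2 \/ i = l.+1 \/ i = l.+2 by lia.
  - by case: (near i).
  - by case: (near2 i).
  - by case: (near l).
  - by case: (near2 l).
have [->|[?|?]] : i = l \/ (i.+2 < l)%N \/ (l.+2 < i)%N by lia.
- by [].
- by apply: hC3.
- by apply/esym/hC3.
Qed.

Lemma val_Bv_lt2 m : (m < 2)%N -> val (Bv m) = 0.
Proof.
move=> lt; rewrite /= (_ : (2 * m - 2)%N = 0%N) ?h0 ?mul0r ?scaler0 //; lia.
Qed.

Lemma mul_signs (x y : A) (a c d : bool) : x * y = (-1) ^+ a * (y * x) ->
  forall z, z * y = (-1) ^+ c * (y * z) -> d = a (+) c ->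
  (x * z) * y = (-1) ^+ d * (y * (x * z)).
Proof.
move=> xy z zy ->; rewrite -mulrA zy [x * (_ * _)]mulrA [x * _]commr_sign.
rewrite -[_ * x * _]mulrA [x * (_ * _)]mulrA xy signr_addb -!mulrA.
by rewrite [LHS]mulrA commr_sign -mulrA.
Qed.

(** Confirms that [vadj] is the frustration graph of the values. The spurious vertices [Bv 0] and
    [Bv 1] satisfy the rule because their values vanish. *)
Lemma vadj_comm v w : val v * val w = (-1) ^+ vadj v w * (val w * val v).
Proof.
have BH m l : val (Bv m) * h l = (-1) ^+ vadj (Bv m) (Hv l) * (h l * val (Bv m)).
  have [lt|m2] := ltnP m 2; first by rewrite val_Bv_lt2 ?mul0r ?mulr0 ?mul0r.
  case: l => [|l]; first by rewrite h0 mulr0 mul0r mulr0.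
  rewrite vadj_BH // [val _]/= -scalerAl -!scalerAr; congr (_ *: _).
  apply: mul_signs (hadj_comm _ _) _; last reflexivity.
  by apply: mul_signs (hadj_comm _ _) _; last reflexivity; apply: hadj_comm.
have inv x y (a : bool) : x * y = (-1) ^+ a * (y * x) -> y * x = (-1) ^+ a * (x * y) :> A.
  by move=> ->; rewrite mulrA -signr_addb addbb mul1r.
case: v w => [i|m] [l|m'].
- rewrite /= hadj_comm; congr ((-1) ^+ nat_of_bool _ * _).
  by rewrite /hadj; apply/idP/idP; lia.
- by rewrite vadjC; apply/inv/BH.
- exact: BH.
have [lt|m2] := ltnP m 2; first by rewrite val_Bv_lt2 ?mul0r ?mulr0 ?mul0r.
have [lt|m2'] := ltnP m' 2; first by rewrite (val_Bv_lt2 lt) ?mul0r ?mulr0 ?mul0r.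
have HB l : h l * val (Bv m') = (-1) ^+ vadj (Hv l) (Bv m') * (val (Bv m') * h l).
  by rewrite vadjC; apply/inv/BH.
move: (val (Bv m')) HB => y HB.
rewrite /= -scalerAl -!scalerAr; congr (_ *: _).
rewrite (mul_signs (mul_signs (HB (2 * m - 2)%N) (HB (2 * m - 3)%N) erefl)
  (HB (2 * m)%N) erefl).
congr ((-1) ^+ nat_of_bool _ * _).
exact/esym/vadj_BB.
Qed.

Variable u : K.

Definition tau (n : nat) : A := itp val u predT (evert n).

Lemma itp_predT (ok : pred vkind) V :
  (forall v, List.In v V -> ok v) -> itp val u ok V = itp val u predT V.
Proof. by move=> E; apply: eq_in_itp => v /E ->. Qed.

(** The three new vertices are pairwise adjacent, so an independent set contains at most one of
    them. *)
Lemma itp_evertS (ok : pred vkind) n :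
  let term v := if ok v then
    u *: (val v * itp val u (fun w => ok w && ~~ vadj v w) (evert n)) else 0 in
  itp val u ok (evert n.+1) = itp val u ok (evert n)
    - term (Bv n.+1) - term (Hv n.*2.+2) - term (Hv n.*2.+1).
Proof.
move=> term; rewrite /term.
have -> : evert n.+1 = [:: Hv n.*2.+1, Hv n.*2.+2, Bv n.+1 & evert n] by [].
have E1 : vadj (Hv n.*2.+1) (Hv n.*2.+2) by rewrite /=; lia.
have E2 : vadj (Hv n.*2.+1) (Bv n.+1) by rewrite /=; lia.
have E3 : vadj (Hv n.*2.+2) (Bv n.+1) by rewrite /=; lia.
by rewrite !itp_cons E1 E2 E3 !andbF !subr0.
Qed.

Lemma itp_evert (ok : pred vkind) n :
  (forall l, (1 <= l <= n.*2)%N -> ok (Hv l)) ->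
  (forall m, (1 <= m <= n)%N -> ok (Bv m)) ->
  itp val u ok (evert n) = tau n.
Proof.
move=> okH okB; apply: itp_predT => v /evert_inv.
by case: v; [exact: okH | exact: okB].
Qed.

Lemma tau_delete n (ok : pred vkind) :
  (forall l, (1 <= l <= n.+1.*2)%N -> ok (Hv l) = (l <= n.*2)%N) ->
  (forall m, (1 <= m <= n.+1)%N -> ok (Bv m) = (m <= n)%N) ->
  itp val u ok (evert n.+1) = tau n.
Proof.
move=> okH okB; rewrite itp_evertS !(okH, okB); try lia.
rewrite !ltnn (_ : _ <= _ = false)%N; last lia.
rewrite !subr0; apply: itp_evert => l ?; rewrite ?okH ?okB; lia.
Qed.

Lemma eq_itp_evert (ok ok' : pred vkind) n :
  (forall l, (1 <= l <= n.*2)%N -> ok (Hv l) = ok' (Hv l)) ->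
  (forall m, (1 <= m <= n)%N -> ok (Bv m) = ok' (Bv m)) ->
  itp val u ok (evert n) = itp val u ok' (evert n).
Proof.
by move=> EH EB; apply: eq_in_itp => -[l|m] /evert_inv; [exact: EH | exact: EB].
Qed.

Ltac okval o t b := have -> : t = b by unfold o; rewrite /=; lia.

(** Each of the three top vertices removes its neighbours from the smaller graph. For [Bv n.+4]
    these are [Bv n.+3] and the letters 2n+3 and 2n+5, so what survives is T_{2n+4} without the
    letter 2n+3, plus the term of the letter 2n+6. *)
Lemma tau_rec n : tau n.+4 = tau n.+3
  - u *: (val (Bv n.+4) *
      (tau n.+2 + u *: (h n.+1.*2.+1 * tau n) - u *: (h n.+2.*2.+2 * tau n.+1)))
  - u *: (h n.+3.*2.+2 * (tau n.+2 - u *: (h n.+2.*2.+1 * tau n.+1)))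
  - u *: (h n.+3.*2.+1 * tau n.+2).
Proof.
rewrite {1}/tau itp_evertS -/(tau n.+3); cbv beta.
rewrite -!(fun v => erefl : val (Hv v) = h v).
set okc := fun w => predT w && ~~ vadj (Bv n.+4) w.
set okb := fun w => predT w && ~~ vadj (Hv n.+3.*2.+2) w.
set oka := fun w => predT w && ~~ vadj (Hv n.+3.*2.+1) w.
have -> : itp val u oka (evert n.+3) = tau n.+2.
  by apply: tau_delete => k ?; rewrite /oka /=; lia.
have -> : itp val u okb (evert n.+3) =
    tau n.+2 - u *: (h n.+2.*2.+1 * tau n.+1).
  rewrite itp_evertS.
  okval okb (okb (Bv n.+3)) false; okval okb (okb (Hv n.+2.*2.+2)) false.
  okval okb (okb (Hv n.+2.*2.+1)) true; rewrite !subr0.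
  congr (_ - _ *: (_ * _)).
    by apply: itp_evert => k ?; rewrite /okb /=; lia.
  by apply: tau_delete => k ?; rewrite /okb /=; lia.
have -> : itp val u okc (evert n.+3) = tau n.+2 + u *: (h n.+1.*2.+1 * tau n)
    - u *: (h n.+2.*2.+2 * tau n.+1).
  rewrite itp_evertS.
  okval okc (okc (Bv n.+3)) false; okval okc (okc (Hv n.+2.*2.+2)) true.
  okval okc (okc (Hv n.+2.*2.+1)) false; rewrite !subr0.
  congr (_ - _ *: (_ * _)); last first.
    by apply: tau_delete => k ?; rewrite /okc /=; lia.
  (* Expanding [tau n.+2] over its last clique shows that adding back the term of the letter 2n+3
     amounts to deleting that vertex. *)
  have -> : tau n.+2 = itp val u predT (evert n.+1)
    - u *: (val (Bv n.+2) *
        itp val u (fun w => predT w && ~~ vadj (Bv n.+2) w) (evert n.+1))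
    - u *: (val (Hv n.+1.*2.+2) *
        itp val u (fun w => predT w && ~~ vadj (Hv n.+1.*2.+2) w) (evert n.+1))
    - u *: (val (Hv n.+1.*2.+1) *
        itp val u (fun w => predT w && ~~ vadj (Hv n.+1.*2.+1) w) (evert n.+1)).
    exact: itp_evertS.
  rewrite itp_evertS.
  okval okc (okc (Bv n.+2)) true; okval okc (okc (Hv n.+1.*2.+2)) true.
  okval okc (okc (Hv n.+1.*2.+1)) false; cbv beta; rewrite subr0.
  rewrite [X in _ - _ *: (val (Hv n.+1.*2.+1) * X)](_ : _ = tau n); last first.
    by apply: tau_delete => k ?; rewrite /=; lia.
  rewrite subrK; congr (_ - _ *: (_ * _) - _ *: (_ * _)).
  - by apply: eq_itp_evert => k ?; rewrite /okc /=; lia.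
  - by apply: eq_itp_evert => k ?; rewrite /okc /=; lia.
  - by apply: eq_itp_evert => k ?; rewrite /okc /=; lia.
by [].
Qed.

Lemma tau_comm n l : (n.*2.+2 < l)%N -> h l * tau n = tau n * h l.
Proof.
move=> lt; apply: itp_comm => v /evert_inv vn.
rewrite -[h l]/(val (Hv l)) vadj_comm (_ : vadj _ _ = false) ?mul1r //.
by case: v vn => /= k ?; lia.
Qed.

Lemma tau_odd n :
  itp val u predT (Hv n.+1.*2.+1 :: evert n.+1) =
  tau n.+1 - u *: (h n.+1.*2.+1 * tau n).
Proof.
rewrite [LHS]/=; congr (_ - _ *: (_ * _)).
by apply: tau_delete => k ?; rewrite /=; lia.
Qed.

End Chain.

(* Symbolic letters for a window of the chain *)
Declare Scope nc_scope.
Delimit Scope nc_scope with nc.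
Bind Scope nc_scope with ncexpr.
Notation "x + y" := (Add x y) : nc_scope.
Notation "- x" := (Opp x) : nc_scope.
Notation "x - y" := (Add x (Opp y)) : nc_scope.
Notation "x * y" := (Mul x y) : nc_scope.

(* Letters: 0..19 are h_{B+i} with B = 2 n0, 20..23 are T_B, T_{B+2}, T_{B+4},
   T_{B+6}, 24..43 the squares b_{B+i}^2, 44 is u, and 45+i is beta_{B+i}. *)
Definition window_rule (i j : nat) : option bool :=
  if (24 <= i)%N || (24 <= j)%N then Some false
  else if (i < 20)%N && (j < 20)%N then Some (hadj i j)
  else if (i < 24)%N && (j < 20)%N && ((i - 20).*2.+2 < j)%N then Some false
  else None.

Definition window_square (i : nat) : option nat :=
  if (i < 20)%N then Some (24 + i)%N else None.

Definition xh k := Var k.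
Definition xt k := Var (20 + k).
Definition xb2 k := Var (24 + k).
Definition xu := Var 44.
Definition xbeta k := Var (45 + k).
Definition xB k := (xbeta k.-1 * (xh (k - 2) * xh (k - 3) * xh k))%nc.
Definition xstep k T3 T2 T1 T0 := (T3
  - xu * (xB (k.*2 + 8) * (T2 + xu * (xh (k.*2 + 3) * T0) - xu * (xh (k.*2 + 6) * T1)))
  - xu * (xh (k.*2 + 8) * (T2 - xu * (xh (k.*2 + 5) * T1)))
  - xu * (xh (k.*2 + 7) * T2))%nc.
Definition xT4 := xstep 0 (xt 3) (xt 2) (xt 1) (xt 0).
Definition xT5 := xstep 1 xT4 (xt 3) (xt 2) (xt 1).
Definition xT6 := xstep 2 xT5 xT4 (xt 3) (xt 2).
Definition xT7 := xstep 3 xT6 xT5 xT4 (xt 3).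
Definition xT8 := xstep 4 xT7 xT6 xT5 xT4.
(** [xX] is the clique added to size B+14, and [xE] is the sum over the two cliques before it. All
    their letters have index at least 9, hence commute with T_B, ..., T_{B+6}; this is why unfolding
    stops at these four. *)
Definition xX := (xh 15 + (xh 16 + xB 16))%nc.
Definition xE := (xh 11 + (xh 12 + xB 12) + (xh 13 + (xh 14 + xB 14)))%nc.
Definition ncomm x y := (x * y - y * x)%nc.
Definition nanti x y := (x * y + y * x)%nc.
Definition xtwo := (One + One)%nc.

(** * One step of the even chain *)

(** With [H, t] = 0, the commutator of H with {X, t} is {[H, X], t}, and that of X with it is
    [X^2, t] = 0. What remains is 2 [X, t] - U {[H, X], t}, a condition on a few letters near the
    end. *)
Lemma deformed_commute (A : nzRingType) (U H X t t' : A) :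
  central U -> H * t = t * H -> X * X * t = t * (X * X) ->
  (1 + 1) * (X * t - t * X)
    = U * ((H * X - X * H) * t + t * (H * X - X * H)) ->
  (1 + 1) * t' = (1 + 1) * t - U * (X * t + t * X) ->
  (1 + 1) * ((H + X) * t' - t' * (H + X)) = 0.
Proof.
move=> cU Ht XXt Xt t'E.
transitivity ((H + X) * ((1 + 1) * t') - ((1 + 1) * t') * (H + X)).
  by nc_ring 0%N [:: H; X; t'].
rewrite t'E.
transitivity ((1 + 1) * (H * t - t * H)
  - U * (X * (H * t - t * H) + (H * t - t * H) * X)
  + ((1 + 1) * (X * t - t * X) - U * ((H * X - X * H) * t + t * (H * X - X * H)))
  - U * (X * X * t - t * (X * X))).
  by nc_ring 1%N [:: U; H; X; t].
by rewrite Xt Ht XXt !subrr !(mulr0, mul0r, addr0, subr0).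
Qed.

Section EvenStep.
Variables (K : comNzRingType) (A : algType K).
Variables (h : nat -> A) (b beta : nat -> K) (u : K).
Hypothesis h0 : h 0 = 0.
Hypothesis hsq : forall m, h m * h m = b m ^+ 2 *: 1.
Hypothesis hC1 : forall m, h m * h m.+1 = - (h m.+1 * h m).
Hypothesis hC2 : forall m, h m * h m.+2 = - (h m.+2 * h m).
Hypothesis hC3 : forall m l, (m.+2 < l)%N -> h m * h l = h l * h m.

Notation val := (@vval K A h beta).
Notation tau := (tau h beta u).

Let algM (x y : K) : (x * y)%:A = x%:A * y%:A :> A.
Proof. by rewrite -scalerAl mul1r scalerA. Qed.

Let algD (x y : K) : (x + y)%:A = x%:A + y%:A :> A.
Proof. exact: scalerDl. Qed.

Let algB (x y : K) : (x - y)%:A = x%:A - y%:A :> A.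
Proof. exact: scalerBl. Qed.

Section Window.
Variable n0 : nat.

Definition window (i : nat) : A :=
  if (i < 20)%N then h (n0.*2 + i)
  else if (i < 24)%N then tau (n0 + (i - 20))
  else if (i < 44)%N then (b (n0.*2 + (i - 24)) ^+ 2)%:A
  else if i == 44 then u%:A else (beta (n0.*2 + (i - 45)))%:A.

Notation ev := (nceval window).

Lemma window_central i x : (24 <= i)%N -> window i * x = x * window i.
Proof.
rewrite /window => le; rewrite ltnNge (leq_trans _ le) // ltnNge le /=.
have cen (a : K) (y : A) : a%:A * y = y * a%:A.
  by rewrite -scalerAl -scalerAr mul1r mulr1.
by case: ifP => // _; case: ifP.
Qed.

Lemma window_cm i j s : window_rule i j = Some s ->
  window i * window j = (-1) ^+ s * (window j * window i).
Proof.
rewrite /window_rule; case: ifP => [/orP[le|le] [<-]|_].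
- by rewrite mul1r window_central.
- by rewrite mul1r (window_central _ le).
case: ifP => [/andP[i20 j20] [<-]|nij].
  rewrite /window i20 j20 (hadj_comm hC1 hC2 hC3).
  by rewrite /hadj eqn_add2l -!addnS !leq_add2l.
case: ifP => // /andP[/andP[i24 j20] lt] [<-].
have i20 : (i < 20)%N = false by move: nij; rewrite j20 andbT.
rewrite /window i20 i24 j20 mul1r (tau_comm beta h0 hC1 hC2 hC3 u) //; lia.
Qed.

Lemma window_sq i c : window_square i = Some c -> window i * window i = window c.
Proof.
rewrite /window_square; case: ifP => // lt [<-]; rewrite /window lt hsq.
have -> : (24 + i < 20)%N = false by lia.
have -> : (24 + i < 24)%N = false by lia.
have -> : (24 + i < 44)%N by lia.
by rewrite addKn.
Qed.

Lemma window_eq x y : nf window_rule window_square (Add x (Opp y)) = [::] -> ev x = ev y.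
Proof. by apply: nceval_eq; [exact: window_cm | exact: window_sq]. Qed.

Lemma ev_xB k m : (4 <= k < 20)%N -> (2 * m = n0.*2 + k)%N -> ev (xB k) = val (Bv m).
Proof.
move=> /andP[k4 k20] mE; rewrite /= /window.
have -> : (45 + k.-1 < 20)%N = false by lia.
have -> : (45 + k.-1 < 24)%N = false by lia.
have -> : (45 + k.-1 < 44)%N = false by lia.
have -> : (45 + k.-1 == 44)%N = false by lia.
have -> : (k - 2 < 20)%N by lia.
have -> : (k - 3 < 20)%N by lia.
rewrite k20 mulr_algl mE; congr (beta _ *: (h _ * h _ * h _)); lia.
Qed.

Lemma ev_xh k : (k < 20)%N -> ev (xh k) = h (n0.*2 + k).
Proof. by rewrite /= /window => ->. Qed.

Lemma ev_xstep k T3 T2 T1 T0 : (k <= 4)%N ->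
  ev T3 = tau (n0 + k.+3) -> ev T2 = tau (n0 + k.+2) ->
  ev T1 = tau (n0 + k.+1) -> ev T0 = tau (n0 + k) ->
  ev (xstep k T3 T2 T1 T0) = tau (n0 + k.+4).
Proof.
rewrite !addnS.
move=> k4 E3 E2 E1 E0; rewrite (tau_rec h beta u) /xstep.
have evM x y : ev (x * y)%nc = ev x * ev y by [].
have evD x y : ev (x + y)%nc = ev x + ev y by [].
have evN x : ev (- x)%nc = - ev x by [].
have evU : ev xu = u%:A by [].
have EB : ev (xB (k.*2 + 8)) = val (Bv (n0 + k).+4) by apply: ev_xB; lia.
(* The composite letter is made opaque so that the evaluation rules below do not split its
   product. *)
move: (xB _) EB => B EB.
rewrite !(evM, evD, evN) E3 E2 E1 E0 EB !evU !mulr_algl !ev_xh; try lia.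
have hE i j : i = j -> h i = h j by move=> ->.
rewrite (hE (n0 + k).+1.*2.+1 (n0.*2 + (k.*2 + 3))%N); last lia.
rewrite (hE (n0 + k).+2.*2.+2 (n0.*2 + (k.*2 + 6))%N); last lia.
rewrite (hE (n0 + k).+3.*2.+2 (n0.*2 + (k.*2 + 8))%N); last lia.
rewrite (hE (n0 + k).+2.*2.+1 (n0.*2 + (k.*2 + 5))%N); last lia.
by rewrite (hE (n0 + k).+3.*2.+1 (n0.*2 + (k.*2 + 7))%N); last lia.
Qed.

Lemma ev_xt k : (k < 4)%N -> ev (xt k) = tau (n0 + k).
Proof.
move=> k4; rewrite /= /window.
have -> : (20 + k < 20)%N = false by lia.
have -> : (20 + k < 24)%N by lia.
by rewrite addKn.
Qed.

Lemma ev_xT4 : ev xT4 = tau (n0 + 4).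
Proof. by apply: ev_xstep; rewrite ?ev_xt. Qed.

Lemma ev_xT5 : ev xT5 = tau (n0 + 5).
Proof. by apply: ev_xstep; rewrite ?ev_xt ?ev_xT4. Qed.

Lemma ev_xT6 : ev xT6 = tau (n0 + 6).
Proof. by apply: ev_xstep; rewrite ?ev_xt ?ev_xT4 ?ev_xT5. Qed.

Lemma ev_xT7 : ev xT7 = tau (n0 + 7).
Proof. by apply: ev_xstep; rewrite ?ev_xt ?ev_xT4 ?ev_xT5 ?ev_xT6. Qed.

Lemma ev_xT8 : ev xT8 = tau (n0 + 8).
Proof. by apply: ev_xstep; rewrite ?ev_xT4 ?ev_xT5 ?ev_xT6 ?ev_xT7. Qed.

End Window.

Definition clique_sum n := h n.*2.+1 + (h n.*2.+2 + val (Bv n.+1)).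
Definition even_ham n := \sum_(v <- evert n) val v.

Lemma even_hamS n : even_ham n.+1 = clique_sum n + even_ham n.
Proof. by rewrite /even_ham [evert _]/= !big_cons /clique_sum -!addrA. Qed.

Lemma even_ham_comm n x :
  (forall v, List.In v (evert n) -> x * val v = val v * x) ->
  x * even_ham n = even_ham n * x.
Proof.
rewrite /even_ham; elim: (evert n) => [|v V IH] E; first by rewrite big_nil mulr0 mul0r.
rewrite big_cons mulrDr mulrDl E; last by left.
by rewrite IH // => w wV; apply: E; right.
Qed.

Lemma val_comm v w : vadj v w = false -> val v * val w = val w * val v.
Proof. by move=> E; rewrite (vadj_comm beta h0 hC1 hC2 hC3) E mul1r. Qed.

Lemma even_ham_commH n l : (n.*2.+2 < l)%N ->
  h l * even_ham n = even_ham n * h l.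
Proof.
move=> lt; apply: even_ham_comm => v /evert_inv vn.
by apply: (@val_comm (Hv l)); case: v vn => k ? /=; lia.
Qed.

Lemma even_ham_commB n m : (n.+3 <= m)%N ->
  val (Bv m) * even_ham n = even_ham n * val (Bv m).
Proof.
move=> lt; apply: even_ham_comm => v /evert_inv vn.
by apply: val_comm; case: v vn => k ? /=; lia.
Qed.

Notation brk x y := (x * y - y * x).
Notation abrk x y := (x * y + y * x).

Section Window7.
Variable n0 : nat.
Notation ev := (nceval (window n0)).

Let evM x y : ev (x * y)%nc = ev x * ev y. Proof. by []. Qed.

Let evD x y : ev (x + y)%nc = ev x + ev y. Proof. by []. Qed.

Let hE i j : i = j -> h i = h j. Proof. by move=> ->. Qed.

Let ev_clique k : (4 <= k.*2.+2 < 20)%N ->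
  ev (xh k.*2.+1 + (xh k.*2.+2 + xB k.*2.+2))%nc = clique_sum (n0 + k).
Proof.
move=> k20; have EB : ev (xB k.*2.+2) = val (Bv (n0 + k).+1) by apply: ev_xB; lia.
move: (xB _) EB => B EB; rewrite /clique_sum -EB.
rewrite (@hE (n0 + k).*2.+2 (n0.*2 + k.*2.+2)%N); last lia.
rewrite (@hE (n0 + k).*2.+1 (n0.*2 + k.*2.+1)%N); last lia.
by rewrite -!ev_xh //; lia.
Qed.

Let ev_xX : ev xX = clique_sum (n0 + 7).
Proof. exact: (@ev_clique 7). Qed.

(** The three clique members anticommute pairwise, so the cross terms cancel and the sum of their
    squares [c] is left. *)
Lemma clique_sum_sq_window : central (clique_sum (n0 + 7) * clique_sum (n0 + 7)).
Proof.
pose c := (xb2 15 + xb2 16 + xbeta 15 * xbeta 15 * (xb2 13 * (xb2 14 * xb2 16)))%nc.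
move=> y; rewrite -ev_xX.
have -> : ev xX * ev xX = ev c by apply: (@window_eq n0 (xX * xX)); vm_compute.
have cM v w : central v -> central w -> central (v * w : A).
  by move=> cv cw z; rewrite -mulrA cw mulrA cv -mulrA.
have cD v w : central v -> central w -> central (v + w : A).
  by move=> cv cw z; rewrite mulrDl mulrDr cv cw.
have cW i : (24 <= i)%N -> central (window n0 i) by move=> le z; apply: window_central.
move: y; rewrite -/(central (ev c)).
by apply: (cD); [apply: (cD) | apply: (cM); [apply: (cM) |
  apply: (cM); last apply: (cM)]]; apply: cW.
Qed.

(** Both sides unfold to words ending in one of the four base T's and are compared by normal
    form. *)
Lemma tau_clique_window :
  2 *: tau (n0 + 8) = 2 *: tau (n0 + 7)
    - u *: abrk (clique_sum (n0 + 7)) (tau (n0 + 7)).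
Proof.
have two x : 2 *: x = (1 + 1) * x :> A by rewrite scaler_nat mulrDl mul1r.
rewrite !two -mulr_algl -ev_xX -ev_xT7 -ev_xT8.
apply: (@window_eq n0 (xtwo * xT8) (xtwo * xT7 - xu * nanti xX xT7)).
by vm_compute.
Qed.

Let evE : ev xE = clique_sum (n0 + 5) + clique_sum (n0 + 6).
Proof. by rewrite -(@ev_clique 5) // -(@ev_clique 6). Qed.

(** Localises the commutator with the Hamiltonian to its last two cliques, which makes it
    expressible in the window. *)
Lemma even_ham_brk x : (forall y, y = even_ham (n0 + 5) -> x * y = y * x) ->
  brk (even_ham (n0 + 7)) x = brk (ev xE) x.
Proof.
move=> cx; rewrite evE (addnS n0 6) even_hamS (addnS n0 5) even_hamS.
set s6 := clique_sum _.+1; set s5 := clique_sum _.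
rewrite addrA [s6 + s5]addrC mulrDl mulrDr (cx _ erefl).
by rewrite opprD addrACA subrr addr0.
Qed.

(* The only place where the recursion for beta enters: the two claws
   (h_{N+2}, h_{N-1}, h_{N-5} around Bv_N, and h_{N-2}, Bv_{N+2}, h_{N-5} around
   h_{N-3}), together with two b^2-corrections, leave multiples of the same
   [word], with total factor [defect].
   Here N = 2 n0 + 14. *)
Lemma brk_clique_window :
  h (n0.*2 + 9) = 0 \/
  beta (n0.*2 + 15) * (b (n0.*2 + 10) ^+ 2 * beta (n0.*2 + 11)
     - b (n0.*2 + 14) ^+ 2 * beta (n0.*2 + 13) + 1) = beta (n0.*2 + 13) ->
  2 *: brk (clique_sum (n0 + 7)) (tau (n0 + 7)) =
  u *: abrk (brk (even_ham (n0 + 7)) (clique_sum (n0 + 7))) (tau (n0 + 7)).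
Proof.
move=> hyp.
have two x : 2 *: x = (1 + 1) * x :> A by rewrite scaler_nat mulrDl mul1r.
rewrite even_ham_brk => [|y ->]; last first.
  rewrite /clique_sum !mulrDl !mulrDr !even_ham_commH ?even_ham_commB //; lia.
rewrite two -mulr_algl -ev_xX -ev_xT7.
pose word := (xh 9 * (xh 11 * (xh 12 * (xh 13 * (xh 14 * (xh 16 * xt 3))))))%nc.
pose defect := (xbeta 13 - xbeta 15 *
   (xb2 10 * xbeta 11 - xb2 14 * xbeta 13 + One))%nc.
(* At the bottom of the chain the letter 9 vanishes and kills [word]; higher up the recursion for
   beta kills [defect]. *)
have defect0 : ev (defect * word)%nc = 0.
  rewrite evM; case: hyp => [h9|E].
    have -> : ev word = 0.
      transitivity (h (n0.*2 + 9) *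
        ev (xh 11 * (xh 12 * (xh 13 * (xh 14 * (xh 16 * xt 3)))))%nc); last by rewrite h9 mul0r.
      by rewrite evM ev_xh.
    by rewrite mulr0.
  have -> : ev defect = (beta (n0.*2 + 13) - beta (n0.*2 + 15) *
     (b (n0.*2 + 10) ^+ 2 * beta (n0.*2 + 11)
     - b (n0.*2 + 14) ^+ 2 * beta (n0.*2 + 13) + 1))%:A.
    by rewrite algB algM algD algB 2![(_ ^+ 2 * _)%:A]algM scale1r.
  by rewrite E subrr scale0r mul0r.
pose rhs := (xu * nanti (ncomm xE xX) xT7
  + (xtwo * (xtwo * (xu * (xu * xu)))) * (defect * word))%nc.
transitivity (ev rhs).
  by apply: (@window_eq n0 (xtwo * ncomm xX xT7) rhs); vm_compute.
by rewrite evD [ev (_ * (defect * word))%nc]evM defect0 mulr0 addr0.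
Qed.

(** The neighbours of the letter 15 in this graph are exactly the last clique. Products containing
    one of them anticommute with the letter and cancel; the others sum to the previous T and count
    twice. *)
Lemma abrk_odd_window :
  abrk (h (n0.*2 + 15)) (tau (n0 + 7)) = 2 *: (h (n0.*2 + 15) * tau (n0 + 6)).
Proof.
have two x : 2 *: x = (1 + 1) * x :> A by rewrite scaler_nat mulrDl mul1r.
rewrite two -ev_xT7 -ev_xT6 -!ev_xh //.
apply: (@window_eq n0 (nanti (xh 15) xT7) (xtwo * (xh 15 * xT6))).
by vm_compute.
Qed.

(** The odd-size counterpart of [brk_clique_window]; here the words cancel without remainder. *)
Lemma brk_odd_window :
  2 *: brk (h (n0.*2 + 15)) (tau (n0 + 7)) =
  u *: abrk (brk (even_ham (n0 + 7)) (h (n0.*2 + 15))) (tau (n0 + 7)).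
Proof.
have two x : 2 *: x = (1 + 1) * x :> A by rewrite scaler_nat mulrDl mul1r.
rewrite even_ham_brk => [|y ->]; last by rewrite even_ham_commH //; lia.
rewrite two -mulr_algl -ev_xT7 -!ev_xh //.
apply: (@window_eq n0 (xtwo * ncomm (xh 15) xT7) (xu * nanti (ncomm xE (xh 15)) xT7)).
by vm_compute.
Qed.
End Window7.
End EvenStep.

(** * Translating the model by 16 sites *)

Definition vkind_code (v : vkind) : nat + nat :=
  match v with Hv l => inl l | Bv m => inr m end.
Definition vkind_decode (c : nat + nat) : vkind :=
  match c with inl l => Hv l | inr m => Bv m end.
Lemma vkind_codeK : cancel vkind_code vkind_decode.
Proof. by case. Qed.
HB.instance Definition _ := Equality.copy vkind (can_type vkind_codeK).

Lemma Hv_inj : injective Hv. Proof. by move=> i j []. Qed.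
Lemma Bv_inj : injective Bv. Proof. by move=> i j []. Qed.

Lemma List_In_mem (v : vkind) s : List.In v s <-> v \in s.
Proof.
elim: s => //= w s IH; rewrite inE; split=> [[->|/IH ->]|/orP[/eqP->|/IH]].
- by rewrite eqxx.
- by rewrite orbT.
- by left.
- by right.
Qed.

Lemma mem_map_disjoint (f g : nat -> vkind) s i :
  (forall i j, f i <> g j) -> (f i \in map g s) = false.
Proof. by move=> fg; apply/negP => /mapP[j _ /fg]. Qed.

Lemma mem_vert j v : (v \in vert j) =
  match v with Hv l => (1 <= l <= j)%N | Bv m => (2 <= m <= j./2)%N end.
Proof.
rewrite /vert mem_cat; case: v => [l|m].
  rewrite (mem_map Hv_inj) [X in _ || X]mem_map_disjoint // orbF mem_iota; lia.
by rewrite (mem_map Bv_inj) mem_map_disjoint //= mem_iota; lia.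
Qed.

Lemma uniq_vert j : uniq (vert j).
Proof.
rewrite /vert cat_uniq !map_inj_uniq ?iota_uniq //; try by move=> ? ? [].
by rewrite andbT; apply/hasPn => x /mapP[m _ ->]; rewrite mem_map_disjoint.
Qed.

Lemma mem_evert n v : (v \in evert n) =
  match v with Hv l => (1 <= l <= n.*2)%N | Bv m => (1 <= m <= n)%N end.
Proof.
elim: n => [|n IH]; first by case: v => k; rewrite in_nil; lia.
rewrite [evert _]/= !inE {}IH.
have HE i k : (Hv i == Hv k) = (i == k) by apply: (inj_eq Hv_inj).
have BE i k : (Bv i == Bv k) = (i == k) by apply: (inj_eq Bv_inj).
have HBE i k : (Hv i == Bv k) = false by apply/negP => /eqP.
have BHE i k : (Bv i == Hv k) = false by apply/negP => /eqP.
by case: v => k; rewrite !(HE, BE, HBE, BHE); lia.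
Qed.

Lemma uniq_evert n : uniq (evert n).
Proof.
elim: n => //= n IH; rewrite !inE !mem_evert IH andbT.
have HE i k : (Hv i == Hv k) = (i == k) by apply: (inj_eq Hv_inj).
have HBE i k : (Hv i == Bv k) = false by apply/negP => /eqP.
by rewrite !(HE, HBE); lia.
Qed.

Definition everts (j : nat) : seq vkind :=
  if odd j then Hv j :: evert j./2 else evert j./2.

Lemma mem_everts j v : (v \in everts j) =
  match v with Hv l => (1 <= l <= j)%N | Bv m => (1 <= m <= j./2)%N end.
Proof.
rewrite /everts; have HE i k : (Hv i == Hv k) = (i == k) by apply: (inj_eq Hv_inj).
have BHE i k : (Bv i == Hv k) = false by apply/negP => /eqP.
by case: ifP => oj; rewrite ?inE mem_evert; case: v => k; rewrite ?(HE, BHE); lia.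
Qed.

Lemma uniq_everts j : uniq (everts j).
Proof.
rewrite /everts; case: ifP => oj; last exact: uniq_evert.
by rewrite /= uniq_evert mem_evert andbT; lia.
Qed.

(* After moving the model 16 sites to the right the recursion windows never meet
   truncated subtraction, and all letters below the chain vanish. *)
Definition vshift (v : vkind) : vkind :=
  match v with Hv l => Hv (l + 16) | Bv m => Bv (m + 8) end.

Lemma vadj_shift v w : vadj (vshift v) (vshift w) = vadj v w.
Proof. by case: v w => [i|m] [l|m'] /=; apply/idP/idP; lia. Qed.

(** The vertices of the long chain that are not translates: the first eight cliques, and [Bv 9], the
    translate of the spurious [Bv 1], present once j >= 2. *)
Definition junk (j : nat) : seq vkind :=
  (if (j < 2)%N then [::] else [:: Bv 9]) ++ evert 8.

Lemma mem_vshift s v : (v \in map vshift s) =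
  match v with
  | Hv k => (16 <= k)%N && (Hv (k - 16) \in s)
  | Bv k => (8 <= k)%N && (Bv (k - 8) \in s)
  end.
Proof.
apply/mapP/idP => [[[k|k] ks ->]|] /=; rewrite ?addnK ?leq_addl //.
case: v => k /andP[le ks]; first by exists (Hv (k - 16)); rewrite //= subnK.
by exists (Bv (k - 8)); rewrite //= subnK.
Qed.

Lemma perm_vshift j :
  perm_eq (map vshift (vert j) ++ junk j) (everts (j + 16)).
Proof.
have HBE i k : (Hv i == Bv k) = false by apply/negP => /eqP.
have BE i k : (Bv i == Bv k) = (i == k) by apply: (inj_eq Bv_inj).
have memj v : (v \in junk j) =
    match v with Hv l => (1 <= l <= 16)%N | Bv m => (1 <= m <= minn 9 (8 + j./2))%N end.
  rewrite /junk mem_cat mem_evert; case: v => k.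
    by case: ifP => _; rewrite ?in_nil ?inE ?HBE.
  by case: ifP => j2; rewrite ?in_nil ?inE ?BE; lia.
apply: uniq_perm => [||v]; last first.
- rewrite mem_cat memj mem_vshift mem_everts.
  by case: v => k; rewrite mem_vert; lia.
- exact: uniq_everts.
have sh_inj : injective vshift.
  by move=> [i|i] [k|k] //= [] E; [congr Hv | congr Bv]; lia.
rewrite cat_uniq map_inj_uniq // uniq_vert.
apply/andP; split=> //; apply/andP; split.
  apply/hasPn => v; rewrite memj mem_vshift.
  by case: v => k; rewrite mem_vert; lia.
by rewrite /junk cat_uniq uniq_evert; case: ifP.
Qed.

(** * Commutation of Hamiltonian and transfer matrix along the whole chain *)

Section ChainTheorems.
Variables (K : fieldType) (A : algType K).
Variables (h : nat -> A) (b beta : nat -> K).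
Hypothesis h_small : forall l, (l <= 16)%N -> h l = 0.
Hypothesis hsq : forall m, h m * h m = b m ^+ 2 *: 1.
Hypothesis hC1 : forall m, h m * h m.+1 = - (h m.+1 * h m).
Hypothesis hC2 : forall m, h m * h m.+2 = - (h m.+2 * h m).
Hypothesis hC3 : forall m l, (m.+2 < l)%N -> h m * h l = h l * h m.
Hypothesis beta_rec : forall n, (7 <= n)%N -> h (n.*2 - 5) = 0 \/
  beta n.*2.+1 * (b (n.*2 - 4) ^+ 2 * beta (n.*2 - 3)
    - b n.*2 ^+ 2 * beta (n.*2 - 1) + 1) = beta (n.*2 - 1).

Notation val := (@vval K A h beta).
Notation tau := (tau h beta).
Notation X := (clique_sum h beta).
Notation H := (even_ham h beta).
Notation brk x y := (x * y - y * x).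
Notation abrk x y := (x * y + y * x).

Let h0 : h 0 = 0. Proof. exact: h_small. Qed.

Lemma val_small v : v \in evert 8 -> val v = 0.
Proof.
rewrite mem_evert; case: v => k lt /=; first by rewrite h_small //; lia.
by rewrite (h_small (l := 2 * k)) ?mulr0 ?scaler0 //; lia.
Qed.

Lemma even_ham_small n : (n <= 8)%N -> H n = 0.
Proof.
move=> n8; rewrite /even_ham big_seq big1 // => v vn.
by apply: val_small; move: vn; rewrite !mem_evert; case: v => k; lia.
Qed.

Lemma clique_sum_sq n : (7 <= n)%N -> central (X n * X n).
Proof.
by move=> n7; rewrite -(subnK n7); apply: (clique_sum_sq_window beta 0 h0 hsq hC1 hC2 hC3).
Qed.

Lemma tau_clique u n : (7 <= n)%N ->
  2 *: tau u n.+1 = 2 *: tau u n - u *: abrk (X n) (tau u n).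
Proof.
by move=> n7; rewrite -(subnK n7) -addnS; apply: (tau_clique_window beta u h0 hsq hC1 hC2 hC3).
Qed.

Lemma brk_clique u n : (7 <= n)%N ->
  2 *: brk (X n) (tau u n) = u *: abrk (brk (H n) (X n)) (tau u n).
Proof.
move=> n7; have := beta_rec n7; rewrite -(subnK n7); set n0 := (n - 7)%N => rec.
apply: (brk_clique_window u h0 hsq hC1 hC2 hC3).
move: rec.
rewrite (_ : ((n0 + 7).*2 - 5 = n0.*2 + 9)%N); last lia.
rewrite (_ : ((n0 + 7).*2 - 4 = n0.*2 + 10)%N); last lia.
rewrite (_ : ((n0 + 7).*2 - 3 = n0.*2 + 11)%N); last lia.
rewrite (_ : ((n0 + 7).*2 - 1 = n0.*2 + 13)%N); last lia.
rewrite (_ : ((n0 + 7).*2.+1 = n0.*2 + 15)%N); last lia.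
by rewrite (_ : ((n0 + 7).*2 = n0.*2 + 14)%N); last lia.
Qed.

Hypothesis two_neq0 : (2 : K) != 0.

Lemma deformed_commute_scaled (u : K) (x y t t' : A) :
  y * t = t * y -> central (x * x) ->
  2 *: brk x t = u *: abrk (brk y x) t ->
  2 *: t' = 2 *: t - u *: abrk x t ->
  (y + x) * t' = t' * (y + x).
Proof.
move=> yt xx xt t'E; have cu : central (u%:A : A).
  by move=> z; rewrite -scalerAl -scalerAr mul1r mulr1.
have two z : 2 *: z = (1 + 1) * z :> A by rewrite scaler_nat mulrDl mul1r.
have := @deformed_commute A u%:A y x t t' cu yt (xx t).
rewrite !mulr_algl -!two => /(_ xt t'E) /eqP.
by rewrite scaler_eq0 (negbTE two_neq0) subr_eq0 => /eqP.
Qed.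

(** Induction over cliques. Up to n = 8 all values vanish, so H is zero; from there on every step
    fits in a window. *)
Lemma even_ham_tau u n : H n * tau u n = tau u n * H n.
Proof.
have [n8|] := leqP n 8; first by rewrite even_ham_small // mul0r mulr0.
elim: n => // n IH n8.
have {}IH : H n * tau u n = tau u n * H n.
  have [n8'|] := leqP n 8; last exact: IH.
  by rewrite even_ham_small // mul0r mulr0.
rewrite even_hamS [X n + _]addrC.
apply: deformed_commute_scaled IH _ (brk_clique u _) (tau_clique u _); try lia.
by apply: clique_sum_sq; lia.
Qed.

(** The transfer matrix of size 2n+3, in the form given by [tau_odd]. *)
Definition odd_tau u n := tau u n.+1 - u *: (h n.+1.*2.+1 * tau u n).

Lemma odd_tau_clique u n : (7 <= n.+1)%N ->
  2 *: odd_tau u n = 2 *: tau u n.+1 - u *: abrk (h n.+1.*2.+1) (tau u n.+1).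
Proof.
move=> n7; rewrite /odd_tau scalerBr; congr (_ - _).
rewrite scalerA mulrC -scalerA; congr (_ *: _); apply/esym.
have := abrk_odd_window beta u h0 hsq hC1 hC2 hC3 (n.+1 - 7).
rewrite subnK // (_ : (n.+1 - 7 + 6 = n)%N); last lia.
by rewrite (_ : ((n.+1 - 7).*2 + 15 = n.+1.*2.+1)%N); last lia.
Qed.

Lemma odd_ham_tau u n : (7 <= n.+1)%N ->
  (H n.+1 + h n.+1.*2.+1) * odd_tau u n = odd_tau u n * (H n.+1 + h n.+1.*2.+1).
Proof.
move=> n7; apply: deformed_commute_scaled (even_ham_tau u n.+1) _ _ (odd_tau_clique u n7).
  by move=> y; rewrite hsq -scalerAl -scalerAr mul1r mulr1.
have := brk_odd_window beta u h0 hsq hC1 hC2 hC3 (n.+1 - 7).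
rewrite subnK //.
by rewrite (_ : ((n.+1 - 7).*2 + 15 = n.+1.*2.+1)%N); last lia.
Qed.

End ChainTheorems.

(** * The original model read off the translated chain *)

Section Model.
Variables (K : fieldType) (A : algType K).
Variables (h : nat -> A) (beta : nat -> K).
Hypothesis h0 : h 0 = 0.

(** Truncated subtraction sends every index up to 16 to 0, so [h 0 = 0] makes those letters
    vanish. *)
Definition shift_h l := h (l - 16).
Definition shift_beta l := beta (l - 16).

Hypothesis hC1 : forall m, shift_h m * shift_h m.+1 = - (shift_h m.+1 * shift_h m).
Hypothesis hC2 : forall m, shift_h m * shift_h m.+2 = - (shift_h m.+2 * shift_h m).
Hypothesis hC3 : forall m l, (m.+2 < l)%N ->
  shift_h m * shift_h l = shift_h l * shift_h m.

Let sh0 l : (l <= 16)%N -> shift_h l = 0.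
Proof. by move=> l16; rewrite /shift_h (_ : l - 16 = 0)%N //; lia. Qed.

Lemma vval_shift j v : v \in vert j ->
  vval shift_h shift_beta (vshift v) = vval h beta v.
Proof.
rewrite mem_vert /shift_h /shift_beta; case: v => k /= le; first by rewrite addnK.
by congr (beta _ *: (h _ * h _ * h _)); lia.
Qed.

Lemma vval_junk j v : v \in junk j -> vval shift_h shift_beta v = 0.
Proof.
rewrite /junk mem_cat => /orP[|v8]; last by apply: val_small => //; exact: sh0.
case: ifP => // _; rewrite inE => /eqP -> /=.
by rewrite (sh0 (l := 16)) // mul0r mul0r scaler0.
Qed.

Lemma transfer_everts j u : transfer h beta j u =
  itp (vval shift_h shift_beta) u predT (everts (j + 16)).
Proof.
rewrite transferE.
rewrite -(@eq_in_itp_val K A (vval shift_h shift_beta \o vshift)); last first.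
  by move=> v /List_In_mem; apply: vval_shift.
rewrite -(@itp_map _ _ (vval shift_h shift_beta) u vshift predT); last exact: vadj_shift.
rewrite -(@itp_zero_vals _ _ _ _ _ _ (junk j)); last first.
  by move=> v /List_In_mem; apply: vval_junk.
rewrite -[_ ++ _]map_id -[everts _]map_id.
apply: itp_perm (perm_vshift j) => v w E.
by rewrite (vadj_comm _ (sh0 (leq0n _)) hC1 hC2 hC3) E mul1r.
Qed.

Lemma ham_everts j :
  ham h beta j = \sum_(v <- everts (j + 16)) vval shift_h shift_beta v.
Proof.
rewrite hamE -(perm_big _ (perm_vshift j)) [RHS]big_cat big_map.
rewrite [X in _ = _ + X]big_seq [X in _ = _ + X]big1 => [|v]; last exact: vval_junk.
by rewrite [RHS]addr0 big_seq [RHS]big_seq; apply: eq_bigr => v /vval_shift.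
Qed.

Lemma transfer_even n u :
  transfer h beta n.*2 u = tau shift_h shift_beta u (n + 8).
Proof.
rewrite transfer_everts /everts /tau oddD odd_double /=.
by rewrite (_ : (n.*2 + 16)./2 = n + 8)%N //; lia.
Qed.

Lemma transfer_odd n u :
  transfer h beta n.*2.+1 u = odd_tau shift_h shift_beta u (n + 7).
Proof.
rewrite transfer_everts /everts.
have -> : odd (n.*2.+1 + 16) by rewrite addSn /= oddD odd_double.
have -> : ((n.*2.+1 + 16)./2 = (n + 7).+1)%N by lia.
by rewrite (_ : (n.*2.+1 + 16)%N = (n + 7).+1.*2.+1) ?tau_odd //; lia.
Qed.

Lemma ham_even n : ham h beta n.*2 = even_ham shift_h shift_beta (n + 8).
Proof.
rewrite ham_everts /everts /even_ham oddD odd_double /=.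
by rewrite (_ : (n.*2 + 16)./2 = n + 8)%N //; lia.
Qed.

Lemma ham_odd n : ham h beta n.*2.+1 =
  even_ham shift_h shift_beta (n + 8) + shift_h (n + 8).*2.+1.
Proof.
rewrite ham_everts /everts /even_ham.
have -> : odd (n.*2.+1 + 16) by rewrite addSn /= oddD odd_double.
have -> : ((n.*2.+1 + 16)./2 = n + 8)%N by lia.
rewrite big_cons addrC.
by rewrite (_ : (n.*2.+1 + 16)%N = (n + 8).*2.+1) //; lia.
Qed.
End Model.

(** * The independence number *)

Section Independence.
Variables (j : nat) (V : pred vkind).
Hypothesis V_vert : forall v, V v -> v \in vert j.
Hypothesis V_indep : forall v w, V v -> V w -> ~~ vadj v w.

(* Starting points of length-3 intervals that are pairwise disjoint over an
   independent set [V]; the only conflict, between Bv m and h_{2m-2}, is resolved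
   by moving the two intervals one step apart. *)
Definition start (v : vkind) : nat :=
  match v with
  | Hv l => l - (~~ odd l && V (Bv l./2.+1))
  | Bv m => 2 * m - 1 + V (Hv (2 * m - 2))
  end.

Lemma start_range v : V v -> (1 <= start v <= j)%N.
Proof.
move=> Vv; have := V_vert Vv; rewrite mem_vert; case: v Vv => k Vk kj /=.
  case: (boolP (odd k)) => /= ok; first by lia.
  by case: (V _) => /=; lia.
by case: (V _); lia.
Qed.

Lemma start_HH l l' : V (Hv l) -> V (Hv l') -> (l < l')%N ->
  (start (Hv l) + 3 <= start (Hv l'))%N.
Proof.
move=> Vl Vl' lt; have ll' : (l + 3 <= l')%N by have := V_indep Vl Vl'; rewrite /=; lia.
rewrite /=; case: (boolP (odd l')) => /= ol; first by lia.
case E: (V (Bv l'./2.+1)) => /=; last by lia.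
have ne : l' != (l + 3)%N by have := V_indep E Vl; rewrite /=; lia.
by lia.
Qed.

Lemma start_BB m m' : V (Bv m) -> V (Bv m') -> (m < m')%N ->
  (start (Bv m) + 3 <= start (Bv m'))%N.
Proof.
move=> Vm Vm' lt; have mm' : (m + 2 <= m')%N by have := V_indep Vm Vm'; rewrite /=; lia.
have := V_vert Vm; rewrite mem_vert => /andP[m2 _].
by rewrite /=; case: (V _); case: (V _); lia.
Qed.

(** Non-adjacency leaves l <= 2m-6, l = 2m-4, l = 2m-2 or l >= 2m+3. Only l = 2m-2 needs both
    shifts, giving the starts 2m-3 and 2m. *)
Lemma start_HB l m : V (Hv l) -> V (Bv m) ->
  (start (Hv l) + 3 <= start (Bv m))%N || (start (Bv m) + 3 <= start (Hv l))%N.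
Proof.
move=> Vl Vm; have adj := V_indep Vl Vm.
have := V_vert Vm; rewrite mem_vert => /andP[m2 _].
have [El|ne] := eqVneq l (2 * m - 2)%N.
  rewrite /= -El Vl (_ : l./2.+1 = m) ?Vm; last lia.
  by rewrite (_ : odd l = false) /=; lia.
have {adj} : (l + 6 <= 2 * m)%N || (l + 4 == 2 * m)%N || (2 * m + 3 <= l)%N.
  by move: adj ne; rewrite /=; lia.
case/orP=> [lt|lt]; apply/orP; [left|right]; rewrite /=.
  by case: (V (Hv _)); case: (_ && _); lia.
case: (boolP (odd l)) => /= ol; first by case: (V _); lia.
by case: (V _); case: (V _); lia.
Qed.

Lemma start_far v w : V v -> V w -> v != w ->
  (start v + 3 <= start w)%N || (start w + 3 <= start v)%N.
Proof.
case: v w => [l|m] [l'|m'] Vv Vw ne.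
- have [lt|lt|E] := ltngtP l l'; last by rewrite E eqxx in ne.
    by rewrite start_HH.
  by rewrite (start_HH Vw Vv) ?orbT.
- exact: start_HB.
- by rewrite orbC; apply: start_HB.
have [lt|lt|E] := ltngtP m m'; last by rewrite E eqxx in ne.
  by rewrite start_BB.
by rewrite (start_BB Vw Vv) ?orbT.
Qed.
End Independence.

(** Starts at distance at least 3 lie in different blocks of three consecutive integers, and 1..j
    meets (j+2)/3 blocks, rounded down. *)
Lemma indset_card j (S : {set 'I_(nv j)}) :
  indset (@vat j) predT S -> (#|S| <= (j + 2) %/ 3)%N.
Proof.
move=> /forall_inP indS; pose V v := v \in [seq vat i | i <- enum S].
have vat_inj : injective (@vat j).
  move=> i i' E; apply/val_inj/eqP.
  by rewrite -(nth_uniq (Hv 0) (ltn_ord i) (ltn_ord i') (uniq_vert j)) -/(vat i) E.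
have V_vert v : V v -> v \in vert j by move=> /mapP[i _ ->]; apply: mem_nth.
have V_indep v w : V v -> V w -> ~~ vadj v w.
  move=> /mapP[i iS ->] /mapP[i' iS' ->]; rewrite !mem_enum in iS iS'.
  by have /andP[_ /forall_inP] := indS _ iS; apply.
pose g v := ((start V v - 1) %/ 3)%N.
rewrite cardE -(size_map (@vat j)) -(size_map g) -[leqRHS](size_iota 0).
apply: uniq_leq_size => [|k /mapP[v Vv ->]]; last first.
  by rewrite mem_iota /g; have := start_range V_vert Vv; lia.
rewrite map_inj_in_uniq ?map_inj_uniq ?enum_uniq // => v w Vv Vw E.
apply/eqP; apply: contraT => ne; move: E; rewrite /g.
have := start_far V_vert V_indep Vv Vw ne.
by have := start_range V_vert Vv; have := start_range V_vert Vw; lia.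
Qed.

Lemma charge_eq0 (K : comNzRingType) (A : algType K) (h : nat -> A) (beta : nat -> K) j k :
  ((j + 2) %/ 3 < k)%N -> charge h beta j k = 0.
Proof.
move=> lt; rewrite charge_indset big_pred0 // => S; apply/negP.
by move=> /andP[/indset_card le /eqP E]; move: lt; rewrite -E ltnNge le.
Qed.

Import Order.TTheory Num.Theory.

(** * Fermion modes from an edge operator *)

(** Here k stands for u/2. Moving chi across reverses the sign of X and fixes t, so it reverses the
    anticommutator term. *)
Lemma edge_conj (A : nzRingType) (k X t chi : A) : central k ->
  chi * X = - (X * chi) -> chi * t = t * chi ->
  chi * (t - k * (X * t + t * X)) = (t + k * (X * t + t * X)) * chi.
Proof.
move=> ck chiX chit.
transitivity (chi * t - k * ((chi * X) * t + (chi * t) * X)).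
  by nc_ring 1%N [:: k; X; t; chi].
rewrite chiX chit.
transitivity (t * chi - k * (- (X * (chi * t)) + t * (chi * X))).
  by nc_ring 1%N [:: k; X; t; chi].
by rewrite chiX chit; nc_ring 1%N [:: k; X; t; chi].
Qed.

Lemma edge_conjN (A : nzRingType) (k X t chi : A) : central k ->
  chi * X = - (X * chi) -> chi * t = t * chi ->
  chi * (t + k * (X * t + t * X)) = (t - k * (X * t + t * X)) * chi.
Proof.
move=> ck chiX chit; have := @edge_conj A (- k) X t chi _ chiX chit.
by rewrite !mulNr opprK; apply=> y; rewrite mulNr mulrN ck.
Qed.

Section EdgeMode.
Variables (A : nzRingType) (k X t t' chi : A).
Hypothesis ck : central k.
Hypothesis XXt : X * X * t = t * (X * X).
Hypothesis chiX : chi * X = - (X * chi).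
Hypothesis chit : chi * t = t * chi.

Let T := t - k * (X * t + t * X).

(** Once chi is moved to the right, the two sides differ by a multiple of [X^2, t]. *)
Lemma edge_intertwine :
  (1 - (k + k) * X) * (chi * T) = T * ((1 + (k + k) * X) * chi).
Proof.
rewrite edge_conj // /T.
transitivity ((t - k * (X * t + t * X)) * ((1 + (k + k) * X) * chi)
  - (k * k + k * k) * (X * X * t - t * (X * X)) * chi).
  by nc_ring 1%N [:: k; X; t; chi].
by rewrite XXt subrr mulr0 mul0r subr0.
Qed.

Hypothesis chit' : chi * t' = t' * chi.
Hypothesis ctt : central (t' * t).

Let T' := t' + k * (X * t' + t' * X).

(** [T'] plays the role of T(-u). At a root of P_M(u^2) the last term vanishes and the
    anticommutator is the scalar 4 t(-u) t(u). *)
Lemma edge_anti : chi * chi = 1 ->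
  chi * (T' * chi * T) + (T' * chi * T) * chi
    = (1 + 1) * ((1 + 1) * (t' * t)) - (1 + 1) * (T' * T).
Proof.
move=> chi2.
transitivity ((chi * T') * (chi * T) + T' * (chi * T) * chi).
  by nc_ring 0%N [:: T'; T; chi].
rewrite edge_conjN // edge_conj //.
transitivity ((t' - k * (X * t' + t' * X)) * (chi * (t + k * (X * t + t * X))) * chi
   + T' * (t + k * (X * t + t * X)) * (chi * chi)).
  by nc_ring 0%N [:: T'; t; t'; X; k; chi].
rewrite edge_conjN //.
rewrite -[_ * (_ * chi) * chi]mulrA -[_ * chi * chi]mulrA chi2 !mulr1.
rewrite /T' /T.
transitivity ((1 + 1) * ((1 + 1) * (t' * t))
  - (1 + 1) * ((t' + k * (X * t' + t' * X)) * (t - k * (X * t + t * X)))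
  + (k + k) * (X * (t' * t) - (t' * t) * X)).
  by nc_ring 1%N [:: k; X; t; t'].
by rewrite (ctt X) subrr mulr0 addr0.
Qed.
End EdgeMode.

(** * Operator-valued polynomials evaluated at scalars *)

Section CentralEvaluation.
Variables (K : numFieldType) (A : algType K).

Lemma central_alg (u : K) : central (u%:A : A).
Proof. by move=> y; rewrite -scalerAl -scalerAr mul1r mulr1. Qed.

Lemma comm_poly_alg (p : {poly A}) (u : K) : comm_poly p u%:A.
Proof. by apply: comm_coef_poly => i; apply/esym/central_alg. Qed.

Lemma horner_algM (p q : {poly A}) (u : K) :
  (p * q).[u%:A] = p.[u%:A] * q.[u%:A].
Proof. exact/hornerM_comm/comm_poly_alg. Qed.

(** The usual root count survives in a noncommutative algebra with zero divisors, because the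
    evaluation points are central and their differences are invertible scalars. *)
Lemma poly_alg_eq0_seq (s : seq K) (p : {poly A}) : uniq s ->
  (size p <= size s)%N -> (forall u, u \in s -> p.[u%:A] = 0) -> p = 0.
Proof.
elim: s p => [|c s IH] p /=; first by rewrite leqn0 size_poly_eq0 => _ /eqP.
case/andP=> c_s us sz p0; apply/eqP; apply: contraT => pn0.
have /factor_theorem[q pE] : root p c%:A by apply/rootP/p0; rewrite mem_head.
have qn0 : q != 0 by apply: contraNneq pn0 => q0; rewrite pE q0 mul0r.
have q0 : q = 0.
  apply: IH => // [|d ds].
    by move: sz; rewrite pE size_Mmonic ?monicXsubC // size_XsubC addn2.
  have := p0 d; rewrite inE ds orbT pE horner_algM => /(_ isT).
  rewrite hornerXsubC -scalerBl -scalerAr mulr1 => /eqP.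
  rewrite scaler_eq0 subr_eq0 => /orP[/eqP dc|/eqP//].
  by move: c_s; rewrite -dc ds.
by rewrite q0 eqxx in qn0.
Qed.

Lemma poly_alg_eq0 (p : {poly A}) : (forall u : K, p.[u%:A] = 0) -> p = 0.
Proof.
move=> p0; apply: (@poly_alg_eq0_seq [seq n%:R | n <- iota 0 (size p)]).
- by rewrite map_inj_uniq ?iota_uniq //; apply: mulrIn; rewrite oner_eq0.
- by rewrite size_map size_iota.
- by move=> u _; apply: p0.
Qed.

(** Multiplying by the monic, hence regular, factor X - c supplies the missing point. *)
Lemma poly_alg_eq0_but (c : K) (p : {poly A}) :
  (forall u : K, u != c -> p.[u%:A] = 0) -> p = 0.
Proof.
move=> p0; have : p * ('X - (c%:A)%:P) = 0.
  apply: poly_alg_eq0 => u; rewrite horner_algM hornerXsubC.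
  by have [->|/p0 ->] := eqVneq u c; rewrite ?subrr ?mulr0 ?mul0r.
by move=> E; apply: (monic_rreg (monicXsubC (c%:A : A))); rewrite /= E mul0r.
Qed.
Lemma horner_alg_poly n (F : nat -> A) (u : K) :
  (\poly_(k < n) F k).[u%:A] = \sum_(k < n) u ^+ k *: F k.
Proof.
rewrite horner_poly; apply: eq_bigr => k _.
by rewrite exprZn expr1n -scalerAr mulr1.
Qed.
End CentralEvaluation.

(** * Eigenoperators of the Hamiltonian and their anticommutators *)

Section Fermions.
Variables (K : numFieldType) (A : algType K).
Variables (n : nat) (Q : nat -> A) (T t : K -> A) (H X chi : A) (P P0 : {poly K}).
Hypothesis TE : forall u, T u = \sum_(k < n) (- u) ^+ k *: Q k.
Hypothesis Tt : forall u, 2 *: T u = 2 *: t u - u *: (X * t u + t u * X).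
Hypothesis XX : central (X * X).
Hypothesis HT : forall u, H * T u = T u * H.
Hypothesis Hchi : H * chi - chi * H = 2 *: (X * chi).
Hypothesis chiX : chi * X = - (X * chi).
Hypothesis chit : forall u, chi * t u = t u * chi.
Hypothesis chi2 : chi * chi = 1.
Hypothesis TT : forall u, T u * T (- u) = P.[u ^+ 2] *: 1.
Hypothesis tt : forall u, t u * t (- u) = P0.[u ^+ 2] *: 1.

Let TTN u : T (- u) * T u = P.[u ^+ 2] *: 1.
Proof. by rewrite -{2}[u]opprK TT sqrrN. Qed.

Let ttN u : t (- u) * t u = P0.[u ^+ 2] *: 1.
Proof. by rewrite -{2}[u]opprK tt sqrrN. Qed.

Let half u : A := (u / 2)%:A.

Let T_half u : T u = t u - half u * (X * t u + t u * X).
Proof.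
apply: (@scalerI _ _ (2 : K)); first by rewrite pnatr_eq0.
rewrite Tt scalerBr mulr_algl scalerA; congr (_ - _ *: _).
by rewrite mulrC divfK // pnatr_eq0.
Qed.

Let halfD u : half u + half u = u%:A.
Proof. by rewrite -scalerDl -splitr. Qed.

Let T_halfN u : T (- u) = t (- u) + half u * (X * t (- u) + t (- u) * X).
Proof. by rewrite T_half /half mulNr scaleNr mulNr opprK. Qed.

Definition phi u := T (- u) * chi * T u.

(** The intertwining relation multiplied on the left by T(-u). *)
Lemma phi_ode u : phi u - u *: (T (- u) * (X * chi) * T u)
  = P.[u ^+ 2] *: (chi + u *: (X * chi)).
Proof.
have := @edge_intertwine A (half u) X (t u) chi (central_alg (u / 2)) (XX _) chiX (chit u).
rewrite -T_half => E.
have uE y : u *: y = (half u + half u) * y by rewrite halfD mulr_algl.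
have cu : central (half u) by apply: central_alg.
rewrite uE.
transitivity (T (- u) * ((1 - (half u + half u) * X) * (chi * T u))).
  by rewrite /phi; nc_ring 1%N [:: half u; T (- u); X; chi; T u].
rewrite E [LHS]mulrA TTN mulr_algl uE; congr (_ *: _).
by nc_ring 1%N [:: half u; X; chi].
Qed.

Lemma ham_phi u : H * phi u - phi u * H = 2 *: (T (- u) * (X * chi) * T u).
Proof.
rewrite scalerAl scalerAr -Hchi /phi.
transitivity ((H * T (- u)) * chi * T u - T (- u) * chi * (T u * H)).
  by nc_ring 0%N [:: H; T (- u); chi; T u].
rewrite (HT (- u)) -(HT u).
by nc_ring 0%N [:: H; T (- u); chi; T u].
Qed.

Lemma phi_ham_ode u : phi u - (u / 2) *: (H * phi u - phi u * H)
  = P.[u ^+ 2] *: (chi + u *: (X * chi)).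
Proof. by rewrite ham_phi scalerA divfK ?phi_ode // pnatr_eq0. Qed.

Section Root.
Variable a : K.
Hypothesis a0 : a != 0.
Hypothesis Pa : P.[a ^+ 2] = 0.

Lemma ham_phi_root : H * phi a - phi a * H = (2 / a) *: phi a.
Proof.
have := phi_ode a; rewrite Pa scale0r => /eqP; rewrite subr_eq0 => /eqP E.
by rewrite ham_phi [in RHS]E scalerA divfK.
Qed.

Let s : K := 4%:R * P0.[a ^+ 2].

Lemma chi_phi_root : chi * phi a + phi a * chi = s *: 1.
Proof.
have cen : central (t (- a) * t a) by rewrite ttN; apply: central_alg.
have := @edge_anti A (half a) X (t a) (t (- a)) chi (central_alg (a / 2)) chiX
  (chit a) (chit (- a)) cen chi2.
rewrite -T_half -T_halfN TTN ttN Pa scale0r mulr0 subr0 => ->.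
have two x : (1 + 1) * x = 2 *: x :> A by rewrite scaler_nat mulrDl mul1r.
by rewrite !two !scalerA /s -natrM.
Qed.

(** The scalar {chi, phi a} commutes with H, so the Leibniz rule gives {[H, chi], phi a} = - {chi,
    [H, phi a]}, whose two sides are known. *)
Lemma Xchi_phi_root : (X * chi) * phi a + phi a * (X * chi) = - (s / a) *: 1.
Proof.
apply: (@scalerI _ _ (2 : K)); first by rewrite pnatr_eq0.
rewrite scalerDr scalerAl [2 *: (phi a * _)]scalerAr -Hchi.
have /eqP := ham_phi_root; rewrite subr_eq => /eqP Hphi.
transitivity (H * (chi * phi a + phi a * chi) - (chi * phi a + phi a * chi) * H
   - (chi * (H * phi a - phi a * H) + (H * phi a - phi a * H) * chi)).
  by nc_ring 0%N [:: H; chi; phi a].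
rewrite ham_phi_root -scalerAr -scalerAl -scalerDr chi_phi_root.
rewrite (central_alg s H) subrr sub0r !scalerA -scaleNr; congr (_ *: _).
by field; rewrite a0.
Qed.

Definition phi_pair u := phi u * phi a + phi a * phi u.

(** The equation for [phi u] is anticommuted with [phi a]. By the Leibniz rule the eigenvalue 2/a of
    [phi a] contributes the extra term with u/a. *)
Lemma phi_pair_ode u :
  phi_pair u - (u / 2) *: (H * phi_pair u - phi_pair u * H) + (u / a) *: phi_pair u
  = (P.[u ^+ 2] * (s * (1 - u / a))) *: 1.
Proof.
transitivity ((phi u - (u / 2) *: (H * phi u - phi u * H)) * phi a
   + phi a * (phi u - (u / 2) *: (H * phi u - phi u * H))).
  rewrite mulrBl mulrBr -scalerAl -scalerAr addrACA -opprD -scalerDr -/(phi_pair u).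
  rewrite -addrA; congr (_ + _).
  have -> : H * phi_pair u - phi_pair u * H =
     (H * phi u - phi u * H) * phi a + phi a * (H * phi u - phi u * H)
     + (phi u * (H * phi a - phi a * H) + (H * phi a - phi a * H) * phi u).
    by rewrite /phi_pair; nc_ring 0%N [:: H; phi u; phi a].
  rewrite ham_phi_root -scalerAr -scalerAl -scalerDr -/(phi_pair u).
  rewrite [in LHS]scalerDr opprD -addrA scalerA (_ : u / 2 * (2 / a) = u / a).
    by rewrite addNr addr0.
  by field; rewrite a0.
rewrite phi_ham_ode -scalerAl -scalerAr -scalerDr mulrDl mulrDr -scalerAl -scalerAr.
rewrite addrACA -scalerDr chi_phi_root Xchi_phi_root !scalerA -scalerDl scalerA.
by congr (_ *: _); field; rewrite a0.
Qed.

Let Tpoly : {poly A} := \poly_(k < n) ((-1) ^+ k *: Q k).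
Let Tpolym : {poly A} := \poly_(k < n) Q k.

Let TpolyE u : T u = Tpoly.[u%:A].
Proof.
rewrite TE horner_alg_poly; apply: eq_bigr => k _.
by rewrite scalerA -exprMn mulrN1.
Qed.

Let TpolymE u : T (- u) = Tpolym.[u%:A].
Proof. by rewrite TE horner_alg_poly; apply: eq_bigr => k _; rewrite opprK. Qed.

Let phi_poly : {poly A} := Tpolym * chi%:P * Tpoly.
Let phi_pair_poly : {poly A} := phi_poly * (phi a)%:P + (phi a)%:P * phi_poly.

Let phi_pair_polyE u : phi_pair u = phi_pair_poly.[u%:A].
Proof.
have phiE : phi u = phi_poly.[u%:A].
  by rewrite /phi_poly !horner_algM hornerC -TpolyE -TpolymE.
rewrite hornerD [(phi_poly * _).[_]]horner_algM [(_ * phi_poly).[_]]horner_algM.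
by rewrite hornerC -phiE.
Qed.

Let alg_poly (p : {poly K}) : {poly A} := map_poly (GRing.in_alg A) p.

Let alg_polyE p u : (alg_poly p).[u%:A] = p.[u] *: 1.
Proof.
rewrite /alg_poly (_ : u%:A = GRing.in_alg A u :> A) // (horner_map (GRing.in_alg A)).
by [].
Qed.

(* The coefficients of [phi_pair_poly] obey a first-order recursion with scalar
   source, so they all commute with [H]. *)
Lemma ham_phi_pair u : H * phi_pair u = phi_pair u * H.
Proof.
pose r : {poly K} := (P \Po 'X^2) * (s *: (1 - a^-1 *: 'X)).
pose G : {poly A} := H%:P * phi_pair_poly - phi_pair_poly * H%:P.
pose c (x : K) : {poly A} := (x%:A)%:P.
have ode : phi_pair_poly - c 2^-1 * (G * 'X) + c a^-1 * (phi_pair_poly * 'X) - alg_poly r = 0.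
  apply: poly_alg_eq0 => v.
  have GE : G.[v%:A] = H * phi_pair v - phi_pair v * H.
    rewrite phi_pair_polyE /G hornerD hornerN [(H%:P * _).[_]]horner_algM.
    by rewrite [(_ * H%:P).[_]]horner_algM hornerC.
  have cE x (p : {poly A}) : (c x * (p * 'X)).[v%:A] = (v * x) *: p.[v%:A].
    rewrite !horner_algM hornerC hornerX mulr_algl -central_alg mulr_algl scalerA.
    by rewrite mulrC.
  have := phi_pair_ode v; rewrite -GE phi_pair_polyE => E.
  rewrite 3!hornerD 2!hornerN !cE alg_polyE E /r.
  rewrite !(hornerM, horner_comp, hornerXn, hornerZ, hornerD, hornerN, hornerC, hornerX).
  by rewrite [a^-1 * v]mulrC subrr.
rewrite phi_pair_polyE; move: ode; rewrite {}/G; move: phi_pair_poly => p ode.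
have rec k : p`_k = (if k is k'.+1 then
     2^-1 *: (H * p`_k' - p`_k' * H) - a^-1 *: p`_k' else 0)
   + r`_k *: 1.
  have /(congr1 (fun q : {poly A} => q`_k)) := ode.
  rewrite !(coefD, coefN) coef0 !coefCM !coefMX coef_map /=.
  move=> /eqP; rewrite subr_eq0 => /eqP <-.
  case: k => [|k]; first by rewrite !mulr0 subr0 !addr0 add0r.
  rewrite /= coefB coefCM coefMC !mulr_algl.
  by rewrite [RHS]addrC [RHS]addrACA subrK subrr addr0.
have HG k : H * p`_k = p`_k * H.
  elim: k => [|k IH]; rewrite rec mulrDr mulrDl (central_alg _ H) ?mulr0 ?mul0r //.
  congr (_ + _).
  by rewrite IH subrr scaler0 sub0r mulrN mulNr -scalerAr -scalerAl IH.
rewrite horner_coef mulr_sumr mulr_suml; apply: eq_bigr => k _.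
by rewrite exprZn expr1n !mulrA HG -!mulrA (central_alg _ H).
Qed.

(** With the commutator gone and zero source, the equation reads (1 + c/a) [phi_pair c] = 0. *)
Lemma phi_pair_root c : P.[c ^+ 2] = 0 -> c != - a -> phi_pair c = 0.
Proof.
move=> Pc ca; have := phi_pair_ode c.
rewrite ham_phi_pair subrr scaler0 subr0 Pc mul0r scale0r.
rewrite -{1}[phi_pair c]scale1r -scalerDl => /eqP; rewrite scaler_eq0 => /orP[|/eqP//].
rewrite -(mulfV a0) -mulrDl mulf_eq0 invr_eq0 (negbTE a0) orbF addrC addr_eq0.
by rewrite (negbTE ca).
Qed.

(** Since P(u^2) = (u - a)(u + a) R(u^2), dividing (a + u) F(u) = s P(u^2) (a - u) by a + u gives
    F(u) = - s (a - u)^2 R(u^2), which is then evaluated at u = -a. *)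
Lemma phi_pair_opp R : P = ('X - (a ^+ 2)%:P) * R ->
  phi_pair (- a) = - (16%:R * a ^+ 2 * P0.[a ^+ 2] * R.[a ^+ 2]) *: 1.
Proof.
move=> PE; pose q : {poly K} := s *: ((a%:P - 'X) ^+ 2 * (R \Po 'X^2)).
have qE u : q.[u] = s * ((a - u) ^+ 2 * R.[u ^+ 2]).
  by rewrite !(hornerZ, hornerM, horner_comp, hornerXn, horner_exp,
    hornerD, hornerN, hornerC, hornerX).
have : phi_pair_poly + alg_poly q = 0.
  (* The factor 1 + u/a cancels only away from u = -a; the polynomial identity extends to that
     point. *)
  apply: (@poly_alg_eq0_but K A (- a)) => u ua.
  rewrite hornerD -phi_pair_polyE alg_polyE qE.
  have := phi_pair_ode u; rewrite ham_phi_pair subrr scaler0 subr0 PE hornerM hornerXsubC => E.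
  have au : 1 + u / a != 0.
    by rewrite -(mulfV a0) -mulrDl mulf_neq0 ?invr_eq0 // addrC addr_eq0.
  apply: (scalerI au); rewrite scaler0 scalerDr scalerDl scale1r E scalerA -scalerDl.
  rewrite [X in X *: _](_ : _ = 0) ?scale0r //; field; exact: a0.
move=> /(congr1 (fun p : {poly A} => p.[(- a)%:A])).
rewrite hornerD -phi_pair_polyE alg_polyE qE horner0 => /eqP; rewrite addr_eq0 => /eqP ->.
by rewrite -scaleNr; congr (_ *: _); rewrite /s sqrrN; ring.
Qed.
End Root.
End Fermions.

(** T(u) T(-u) has degree at most 2S in u, whereas P(u^2) has twice the degree of P. *)
Lemma size_of_square (K : numFieldType) (A : algType K) (S : nat) (Q : nat -> A)
    (T : K -> A) (P : {poly K}) :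
  (forall u, T u = \sum_(k < S.+1) (- u) ^+ k *: Q k) ->
  (forall u, T u * T (- u) = P.[u ^+ 2] *: 1) -> (size P <= S.+1)%N.
Proof.
move=> TE TT; pose p : {poly A} := \poly_(k < S.+1) ((-1) ^+ k *: Q k).
pose pm : {poly A} := \poly_(k < S.+1) Q k.
have pE u : T u = p.[u%:A].
  rewrite TE horner_alg_poly; apply: eq_bigr => k _.
  by rewrite scalerA -exprMn mulrN1.
have pmE u : T (- u) = pm.[u%:A].
  by rewrite TE horner_alg_poly; apply: eq_bigr => k _; rewrite opprK.
have E : p * pm - map_poly (GRing.in_alg A) (P \Po 'X^2) = 0.
  apply: poly_alg_eq0 => u; rewrite hornerD hornerN horner_algM -pE -pmE TT.
  rewrite (_ : u%:A = GRing.in_alg A u :> A) // (horner_map (GRing.in_alg A)).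
  by rewrite horner_comp hornerXn subrr.
have szM : (size (P \Po 'X^2) <= (S.+1 + S.+1).-1)%N.
  rewrite -(size_map_inj_poly (f := GRing.in_alg A)) ?rmorph0 //; last first.
    exact: fmorph_inj.
  move/eqP: E; rewrite subr_eq0 => /eqP <-.
  apply: leq_trans (size_polyMleq _ _) _.
  by rewrite -!subn1 leq_sub2r // leq_add // size_poly.
have := size_comp_poly P ('X^2 : {poly K}); rewrite size_polyXn.
move: szM; move: (size (P \Po 'X^2)) (size P) => m1 m2; lia.
Qed.

(** * The concrete model satisfies the edge-operator hypotheses *)

Section ModelFacts.
Variables (K : numFieldType) (A : algType K) (M : nat).
Variables (b : nat -> K) (h : nat -> A) (beta : nat -> K) (chi : A).
Hypothesis M1 : (1 <= M)%N.
Hypothesis b0 : b 0 = 0.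
Hypothesis bM : forall l, (M < l)%N -> b l = 0.
Hypothesis h0 : h 0 = 0.
Hypothesis hM : forall l, (M < l)%N -> h l = 0.
Hypothesis hsq : forall m, (1 <= m <= M)%N -> h m * h m = (b m ^+ 2) *: 1.
Hypothesis hC1 : forall m, (1 <= m)%N -> (m.+1 <= M)%N -> h m * h m.+1 = - (h m.+1 * h m).
Hypothesis hC2 : forall m, (1 <= m)%N -> (m.+2 <= M)%N -> h m * h m.+2 = - (h m.+2 * h m).
Hypothesis hC3 : forall m l, (1 <= m)%N -> (m.+2 < l)%N -> (l <= M)%N -> h m * h l = h l * h m.
Hypothesis beta_rec : forall m, (3 <= m)%N ->
  let d := b (2 * m - 4)%N ^+ 2 * beta (2 * m - 3)%N
           - b (2 * m)%N ^+ 2 * beta (2 * m - 1)%N + 1 in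
  d != 0 /\ beta (2 * m + 1)%N = beta (2 * m - 1)%N / d.

Notation sh := (shift_h h).
Notation sb := (shift_beta b).
Notation sbeta := (shift_beta beta).

Let sh_small l : (l <= 16)%N -> sh l = 0.
Proof. by move=> l16; rewrite /shift_h (_ : l - 16 = 0)%N //; lia. Qed.

Let shsq m : sh m * sh m = sb m ^+ 2 *: 1.
Proof.
rewrite /shift_h /shift_beta; move: (m - 16)%N => k.
have [->|k0] := posnP k; first by rewrite h0 b0 mul0r expr0n scale0r.
have [kM|Mk] := leqP k M; first by rewrite hsq ?k0.
by rewrite hM // bM // mul0r expr0n scale0r.
Qed.

Let shC1 m : sh m * sh m.+1 = - (sh m.+1 * sh m).
Proof.
have [le|lt] := leqP m 16; first by rewrite (sh_small le) mul0r mulr0 oppr0.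
rewrite /shift_h subSn; last lia.
have [le|lt'] := leqP (m - 16).+1 M; last by rewrite (hM lt') mul0r mulr0 oppr0.
by apply: hC1; lia.
Qed.

Let shC2 m : sh m * sh m.+2 = - (sh m.+2 * sh m).
Proof.
have [le|lt] := leqP m 16; first by rewrite (sh_small le) mul0r mulr0 oppr0.
rewrite /shift_h !subSn; try lia.
have [le|lt'] := leqP (m - 16).+2 M; last by rewrite (hM lt') mul0r mulr0 oppr0.
by apply: hC2; lia.
Qed.

Let shC3 m l : (m.+2 < l)%N -> sh m * sh l = sh l * sh m.
Proof.
move=> ml; have [le|lt] := leqP m 16; first by rewrite (sh_small le) mul0r mulr0.
rewrite /shift_h; have [le|lt'] := leqP (l - 16) M; last by rewrite (hM lt') mul0r mulr0.
by apply: hC3; lia.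
Qed.

Let sbeta_rec n : (7 <= n)%N -> sh (n.*2 - 5) = 0 \/
  sbeta n.*2.+1 * (sb (n.*2 - 4) ^+ 2 * sbeta (n.*2 - 3)
    - sb n.*2 ^+ 2 * sbeta (n.*2 - 1) + 1) = sbeta (n.*2 - 1).
Proof.
(* For n <= 10 the letter 2n-5 lies among the vanishing ones; from n = 11 on the given recursion
   applies at m = n - 8 >= 3. *)
move=> n7; have [n10|n11] := leqP n 10; [left|right]; first by apply: sh_small; lia.
have m3 : (3 <= n - 8)%N by lia.
have [] := beta_rec m3; rewrite /shift_beta.
rewrite (_ : (n.*2 - 4 - 16 = 2 * (n - 8) - 4)%N); last lia.
rewrite (_ : (n.*2 - 3 - 16 = 2 * (n - 8) - 3)%N); last lia.
rewrite (_ : (n.*2 - 1 - 16 = 2 * (n - 8) - 1)%N); last lia.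
rewrite (_ : (n.*2 - 16 = 2 * (n - 8))%N); last lia.
rewrite (_ : (n.*2.+1 - 16 = 2 * (n - 8) + 1)%N); last lia.
by move=> d0 ->; rewrite divfK.
Qed.

Let two0 : (2 : K) != 0. Proof. by rewrite pnatr_eq0. Qed.

Notation M' := (M - (if odd M then 1 else 2))%N.

Hypothesis chiP : if odd M then
     chi * h M = - (h M * chi) /\
     (forall l, (1 <= l)%N -> (l < M)%N -> chi * h l = h l * chi)
   else
     chi * h M = - (h M * chi) /\ chi * h M.-1 = - (h M.-1 * chi) /\
     (forall l, (1 <= l)%N -> (l < M.-1)%N -> chi * h l = h l * chi).

Let chi_h l : (l <= M')%N -> chi * h l = h l * chi.
Proof.
have [->|l0] := posnP l; first by rewrite h0 mulr0 mul0r.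
by move: chiP; case: ifP => _ [_ H] lM; [|case: H => _ H]; apply: H; lia.
Qed.

Let chi_val v : v \in vert M' -> chi * vval h beta v = vval h beta v * chi.
Proof.
rewrite mem_vert; case: v => k kM /=; first by apply: chi_h; lia.
rewrite -scalerAr -scalerAl; congr (_ *: _).
by rewrite !mulrA chi_h -?[h _ * chi * _]mulrA ?chi_h ?mulrA
  -?[_ * chi * _]mulrA ?chi_h ?mulrA //; lia.
Qed.

Lemma chi_transfer u : chi * transfer h beta M' u = transfer h beta M' u * chi.
Proof. by rewrite transferE; apply: itp_comm => v /List_In_mem; apply: chi_val. Qed.

Lemma chi_ham : chi * ham h beta M' = ham h beta M' * chi.
Proof.
by rewrite hamE mulr_sumr mulr_suml big_seq [RHS]big_seq; apply: eq_bigr => v /chi_val.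
Qed.

(** X is the sum over the simplicial clique: [h M] alone for odd M, the last clique sum for even
    M. *)
Lemma edge_decomposition : exists X : A,
  [/\ ham h beta M = ham h beta M' + X, central (X * X),
    forall u, 2 *: transfer h beta M u = 2 *: transfer h beta M' u
      - u *: (X * transfer h beta M' u + transfer h beta M' u * X),
    forall u, ham h beta M * transfer h beta M u = transfer h beta M u * ham h beta M
    & chi * X = - (X * chi)].
Proof.
have := odd_double_half M; set n := M./2; case: (boolP (odd M)) => oM EM.
  have EM2 : M = n.*2.+1 by rewrite -{1}EM.
  have EM' : M' = n.*2 by rewrite oM EM2 subSS subn0.
  rewrite oM in EM'.
  have TM u : transfer h beta M u = odd_tau sh sbeta u (n + 7).
    by rewrite EM2; apply: transfer_odd h0 shC1 shC2 shC3 _ _.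
  have TM' u : transfer h beta (M - 1) u = tau sh sbeta u (n + 8).
    by rewrite EM'; apply: transfer_even h0 shC1 shC2 shC3 _ _.
  have HM : ham h beta M = even_ham sh sbeta (n + 8) + sh (n + 8).*2.+1.
    by rewrite [in LHS]EM2; apply: ham_odd.
  have HM' : ham h beta (M - 1) = even_ham sh sbeta (n + 8).
    by rewrite EM'; apply: ham_even.
  have XE : sh (n + 8).*2.+1 = h M by rewrite /shift_h EM2; congr h; lia.
  exists (sh (n + 8).*2.+1); split=> [||u|u|].
  - by rewrite HM HM'.
  - by move=> y; rewrite shsq -scalerAl -scalerAr mul1r mulr1.
  - rewrite TM TM' (addnS n 7).
    by apply: (odd_tau_clique sbeta sh_small shsq shC1 shC2 shC3 two0); lia.
  - rewrite TM HM (addnS n 7).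
    by apply: (odd_ham_tau sh_small shsq shC1 shC2 shC3 sbeta_rec two0); lia.
  - by rewrite XE; move: chiP; rewrite oM => -[].
have n0 : (0 < n)%N by move: EM M1 => /=; lia.
have EM2 : M = n.*2 by rewrite -[LHS]EM.
have EM' : (M - 2 = n.-1.*2)%N by rewrite EM2; lia.
have TM u : transfer h beta M u = tau sh sbeta u (n + 7).+1.
  by rewrite EM2 -addnS; apply: transfer_even h0 shC1 shC2 shC3 _ _.
have n7 : (n + 7 = n.-1 + 8)%N by lia.
have TM' u : transfer h beta (M - 2) u = tau sh sbeta u (n + 7).
  by rewrite EM' n7; apply: transfer_even h0 shC1 shC2 shC3 _ _.
have HM : ham h beta M = even_ham sh sbeta (n + 7).+1.
  by rewrite [in LHS]EM2 -addnS; apply: ham_even.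
have HM' : ham h beta (M - 2) = even_ham sh sbeta (n + 7).
  by rewrite EM' n7; apply: ham_even.
exists (clique_sum sh sbeta (n + 7)); split=> [||u|u|].
- by rewrite HM HM' even_hamS addrC.
- by apply: (clique_sum_sq sbeta sh_small shsq shC1 shC2 shC3); lia.
- by rewrite TM TM'; apply: (tau_clique sbeta sh_small shsq shC1 shC2 shC3); lia.
- by rewrite TM HM; apply: (even_ham_tau sh_small shsq shC1 shC2 shC3 sbeta_rec two0).
have ch l : (l <= M - 2)%N -> chi * h l = h l * chi.
  by move=> lM; apply: chi_h; rewrite (negbTE oM).
move: chiP; rewrite (negbTE oM) => -[chM [chM1 _]].
rewrite /clique_sum /= /shift_h /shift_beta.
rewrite (_ : ((n + 7).*2.+1 - 16 = M.-1)%N); last lia.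
rewrite (_ : ((n + 7).*2.+2 - 16 = M)%N); last lia.
rewrite (_ : (2 * (n + 7).+1 - 16 = M)%N); last lia.
rewrite !mulrDr !mulrDl chM chM1 !opprD; congr (_ + (_ + _)).
(* In the composite clique member only the factor [h M] anticommutes with chi; the other two commute
   with it. *)
rewrite -scalerAr -scalerAl -scalerN; congr (_ *: _).
rewrite mulrA [chi * _]mulrA ch; last lia.
rewrite -[h _ * chi * _]mulrA ch; last lia.
by rewrite -!mulrA chM !mulrN.
Qed.
End ModelFacts.

Lemma transfer_at0 (K : comNzRingType) (A : algType K) (h : nat -> A) (beta : nat -> K) j :
  transfer h beta j 0 = 1.
Proof.
rewrite transferE; move: predT; elim: (vert j) => //= v V IH ok.
by rewrite IH; case: ifP => _; rewrite ?scale0r subr0.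
Qed.

(** Bounds the degree of T in u by the independence number, which in turn bounds the degree of
    P_M. *)
Lemma transfer_trunc (K : comNzRingType) (A : algType K) (h : nat -> A) (beta : nat -> K) j u :
  (1 <= j)%N ->
  transfer h beta j u = \sum_(k < ((j + 2) %/ 3).+1) (- u) ^+ k *: charge h beta j k.
Proof.
move=> j1; have le : (((j + 2) %/ 3).+1 <= (nv j).+1)%N.
  by rewrite /nv /vert size_cat !size_map size_iota; lia.
rewrite /transfer.
rewrite (big_ord_widen _ (fun k => (- u) ^+ k *: charge h beta j k) le).
rewrite [RHS]big_mkcond; apply: eq_bigr => k _; case: ifP => // /negbT.
by rewrite -leqNgt => lt; rewrite charge_eq0 ?scaler0.
Qed.

(** S distinct roots exhaust the degree: another zero of the cofactor at z_k would give it S roots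
    with degree below S. *)
Lemma simple_root (K : fieldType) (S : nat) (P : {poly K}) (z : 'I_S -> K) k :
  P != 0 -> (size P <= S.+1)%N -> injective z -> (forall k, root P (z k)) ->
  exists2 R : {poly K}, P = ('X - (z k)%:P) * R & R.[z k] = P^`().[z k] /\ R.[z k] != 0.
Proof.
move=> P0 szP z_inj Pz; have /factor_theorem[R PE] := Pz k.
exists R; first by rewrite mulrC.
split.
  rewrite PE derivM derivB derivX derivC subr0 mulr1 hornerD hornerM.
  by rewrite hornerXsubC subrr mulr0 add0r.
have R0 : R != 0 by apply: contraNneq P0 => R0; rewrite PE R0 mul0r.
apply/negP => /eqP Rzk.
have : (size [seq z i | i <- enum 'I_S] < size R)%N.
  apply: max_poly_roots => //; last by rewrite map_inj_uniq ?enum_uniq.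
  apply/allP => _ /mapP[i _ ->]; have [->|ik] := eqVneq i k; first exact/rootP.
  have := Pz i; rewrite PE rootM root_XsubC => /orP[//|/eqP/z_inj E].
  by rewrite E eqxx in ik.
move: szP; rewrite PE size_Mmonic ?monicXsubC // size_XsubC addn2 /=.
rewrite size_map size_enum_ord ltnS => le lt.
by have := leq_trans lt le; rewrite ltnn.
Qed.

(** * Assembly: eigenvalues and normalised anticommutators *)

Theorem mainTheorem10 (R : realType) (A : algType R[i]) (M : nat)
  (b : nat -> R[i]) (h : nat -> A) (beta : nat -> R[i]) (chi : A)
  (P : nat -> {poly R[i]})
  (z u N : 'I_((M + 2) %/ 3) -> R[i]) :
  (1 <= M)%N ->
  (* conventions h_j = 0, b_j = 0 outside 1..M *)
  b 0%N = 0 -> (forall l, (M < l)%N -> b l = 0) ->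
  h 0%N = 0 -> (forall l, (M < l)%N -> h l = 0) ->
  (* algebra relations *)
  (forall m, (1 <= m <= M)%N -> h m * h m = (b m ^+ 2) *: 1) ->
  (forall m, (1 <= m)%N -> (m.+1 <= M)%N -> h m * h m.+1 = - (h m.+1 * h m)) ->
  (forall m, (1 <= m)%N -> (m.+2 <= M)%N -> h m * h m.+2 = - (h m.+2 * h m)) ->
  (forall m l, (1 <= m)%N -> (m.+2 < l)%N -> (l <= M)%N -> h m * h l = h l * h m) ->
  (* the recursion for beta_{2m+1}, m >= 3, with nonzero denominators *)
  (forall m, (3 <= m)%N ->
     let d := b (2 * m - 4)%N ^+ 2 * beta (2 * m - 3)%N
              - b (2 * m)%N ^+ 2 * beta (2 * m - 1)%N + 1 in
     d != 0 /\ beta (2 * m + 1)%N = beta (2 * m - 1)%N / d) ->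
  (* P_j : T_j(u) T_j(-u) = P_j(u^2) 1, P_0 = 1 *)
  P 0%N = 1 ->
  (forall j, (j <= M)%N -> forall x : R[i],
     transfer h beta j x * transfer h beta j (- x) = (P j).[x ^+ 2] *: 1) ->
  (* right-end simplicial mode chi, chi^2 = 1 *)
  chi * chi = 1 ->
  (if odd M then
     chi * h M = - (h M * chi) /\
     (forall l, (1 <= l)%N -> (l < M)%N -> chi * h l = h l * chi)
   else
     chi * h M = - (h M * chi) /\ chi * h M.-1 = - (h M.-1 * chi) /\
     (forall l, (1 <= l)%N -> (l < M.-1)%N -> chi * h l = h l * chi)) ->
  (* S pairwise distinct roots z_k of P_M with P_{M - r_M}(z_k) <> 0 *)
  injective z ->
  (forall k, root (P M) (z k)) ->
  (forall k, (P (M - (if odd M then 1 else 2))%N).[z k] != 0) ->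
  (forall k, u k ^+ 2 = z k) ->
  (forall k, N k ^+ 2 = 16%:R * ((P (M - (if odd M then 1 else 2))%N).[u k ^+ 2]
                                  * (- (u k ^+ 2) * ((P M)^`()).[u k ^+ 2]))) ->
  (* signed index (k, s): s = true is +k, s = false is -k *)
  let us := fun k (s : bool) => if s then u k else - u k in
  let Psi := fun k (s : bool) =>
    (N k)^-1 *: (transfer h beta M (- us k s) * chi * transfer h beta M (us k s)) in
  (forall k s, ham h beta M * Psi k s - Psi k s * ham h beta M
               = (2%:R * (us k s)^-1) *: Psi k s) /\
  (forall k s k' s', Psi k s * Psi k' s' + Psi k' s' * Psi k s
               = (if (k == k') && (s != s') then 1 else 0)).
Proof.
move=> M1 b0 bM h0 hM hsq hC1 hC2 hC3 rec _ TT chi2 chiP z_inj Pz P0z uz N2 us Psi.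
have [X [HE XX Tt HT chiX]] :=
  edge_decomposition M1 b0 bM h0 hM hsq hC1 hC2 hC3 rec chiP.
have chit := chi_transfer beta M1 h0 chiP.
have chiH := chi_ham beta M1 h0 chiP.
have tt := TT _ (leq_subr (if odd M then 1 else 2)%N M).
have {}TT := TT _ (leqnn M).
have TE v := @transfer_trunc _ A h beta M v M1.
(* Of the two summands of H_M, chi commutes with H_{M-r} and anticommutes with X. *)
have Hchi : ham h beta M * chi - chi * ham h beta M = 2 *: (X * chi).
  rewrite HE mulrDl mulrDr chiH chiX [_ + X * chi]addrC addrKA opprK.
  by rewrite scaler_nat mulr2n.
have szP := size_of_square TE TT.
(* T_M(0) = 1 excludes the root 0, so every u_k is nonzero. *)
have P00 : (P M).[0] != 0.
  have := TT 0; rewrite oppr0 transfer_at0 mulr1 expr0n /= => E.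
  by apply/eqP => P0; move/eqP: E; rewrite P0 scale0r oner_eq0.
have PM0 : P M != 0 by apply: contraNneq P00 => ->; rewrite horner0.
have us2 k s : us k s ^+ 2 = z k by rewrite /us; case: s; rewrite ?sqrrN uz.
have us0 k s : us k s != 0.
  apply: contraNneq P00 => E; have := Pz k.
  by rewrite -(us2 k s) E expr0n => /rootP ->.
have Pus k s : (P M).[us k s ^+ 2] = 0 by rewrite us2; apply/rootP/Pz.
have modeE k s : Psi k s = (N k)^-1 *: phi (transfer h beta M) chi (us k s) by [].
split=> [k s|k s k' s'].
  rewrite modeE -scalerAr -scalerAl -scalerBr.
  rewrite (ham_phi_root Tt XX HT Hchi chiX chit TT (us0 k s) (Pus k s)).
  by rewrite !scalerA mulrC.
have -> : Psi k s * Psi k' s' + Psi k' s' * Psi k s =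
   ((N k)^-1 * (N k')^-1) *: phi_pair (transfer h beta M) chi (us k' s') (us k s).
  by rewrite !modeE -!scalerAr -!scalerAl !scalerA [(N k')^-1 * _]mulrC -scalerDr.
have [opp|nopp] := eqVneq (us k s) (- us k' s'); last first.
  rewrite (phi_pair_root TE Tt XX HT Hchi chiX chit chi2 TT tt
    (us0 k' s') (Pus k' s')) ?Pus //.
  rewrite scaler0; case: ifP => // /andP[/eqP kk ss]; case/eqP: nopp.
  by rewrite kk /us; case: s s' ss => [] [] //; rewrite opprK.
(* Opposite values have equal squares, so injectivity of [z] forces equal indices; nonzero u_k then
   forces opposite signs. *)
have kk : k = k' by apply: z_inj; rewrite -(us2 k s) opp sqrrN us2.
have ss : s != s'.
  apply/eqP => ss; move: opp; rewrite kk ss => /eqP.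
  by rewrite -addr_eq0 -mulr2n mulrn_eq0 (negbTE (us0 _ _)).
rewrite opp kk eqxx ss andTb.
have [Rk PE [RE R0]] := simple_root k' PM0 szP z_inj Pz.
have PE' : P M = ('X - (us k' s' ^+ 2)%:P) * Rk by rewrite us2.
rewrite (phi_pair_opp TE Tt XX HT Hchi chiX chit chi2 TT tt (us0 k' s') (Pus k' s') PE').
(* The cofactor takes the value P_M'(z_k) at z_k, so the squared normalisation is exactly the scalar
   from [phi_pair_opp]. *)
have NE : N k' ^+ 2 = - (16%:R * us k' s' ^+ 2
    * (P (M - (if odd M then 1 else 2))%N).[us k' s' ^+ 2] * Rk.[us k' s' ^+ 2]).
  by rewrite N2 us2 uz RE; ring.
have N0 : N k' != 0.
  rewrite -sqrf_eq0 NE oppr_eq0 !mulf_eq0 us2 (negbTE (us0 _ _)).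
  by rewrite (negbTE (P0z _)) (negbTE R0) pnatr_eq0.
by rewrite scalerA -NE expr2 mulrACA !mulVf // mulr1 scale1r.
Qed.
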